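(* Assume $R>1$. Then for almost every path of the random walk $(X_n)_{n\ge0}$ on the free product $V=V_1\ast\dots\ast V_r$, $$h=\liminf_{n\to\infty}-\frac{\log\pi_n(X_n)}{n},$$ where $h=\lim_{n\to\infty}\frac1n\mathbb{E}[-\log\pi_n(X_n)]$ is the asymptotic entropy.
   Context: Free product. Let $r\ge 2$, $\mathcal I=\{1,\dots,r\}$. For $i\in\mathcal I$ let $V_i$ be a finite or countable set with distinguished root $o_i\in V_i$ (the $V_i$ pairwise disjoint) and let $P_i=(p_i(x,y))_{x,y\in V_i}$ be a stochastic transition matrix, with $n$-step probabilities $p_i^{(n)}(x,y)$. The case $r=2=|V_1|=|V_2|$ is excluded. Standing assumptions: for every $x\in V_i$ there is $n\in\mathbb N$ with $p_i^{(n)}(o_i,x)>0$; $p_i(x,x)=0$ for all $x\in V_i$; uniform irreducibility: there are $\varepsilon_0^{(i)}>0$, $K_i\in\mathbb N$ such that for all $x,y\in V_i$ with $p_i(x,y)>0$ one has $p_i^{(k)}(x,y)\ge\varepsilon_0^{(i)}$ for some $k\le K_i$. Put $V_i^\times=V_i\setminus\{o_i\}$, $V_\ast^\times=\bigcup_i V_i^\times$. The free product $V=V_1\ast\dots\ast V_r$ is the set of all finite words $x_1\dots x_n$ with letters in $V_\ast^\times$, no two consecutive letters from the same $V_i$, together with the empty word $o$. Each $o_i$ is identified with $o$, so $V_i\subseteq V$, and $xo_i:=x$. The type of $u=u_1\dots u_m\in V$ is $\tau(u)=i$ if $u_m\in V_i^\times$; $\tau(o)=0$. Random walk. For $x\in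 V$ with $\tau(x)\ne i$ and $v,w\in V_i$ put $\bar p_i(xv,xw)=p_i(v,w)$, and $\bar p_i=0$ otherwise. Fix $\alpha_1,\dots,\alpha_r>0$ with $\sum_i\alpha_i=1$ and let $P=\sum_i\alpha_i\bar P_i$, with $n$-step probabilities $p^{(n)}(x,y)$. $(X_n)_{n\ge0}$ is the Markov chain on $V$ with $X_0=o$ and transition matrix $P$; $\pi_n$ is the distribution of $X_n$. $R$ denotes the radius of convergence of the Green functions $G(x,y|z)=\sum_{n\ge0}p^{(n)}(x,y)z^n$ (the infimum over $x,y\in V$ of the radii of convergence). When $R>1$ the limit defining $h$ exists. *)

(* Defs.v *)
From HB Require Import structures.
From mathcomp Require Import all_boot all_order all_algebra.
From mathcomp Require Import all_classical all_reals all_analysis.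

Set Implicit Arguments.
Unset Strict Implicit.
Unset Printing Implicit Defensive.

Import Order.TTheory GRing.Theory Num.Theory.
Import numFieldNormedType.Exports.

Local Open Scope classical_set_scope.
Local Open Scope ring_scope.

Section TransitionMatrices.
Context {R : realType} {T : choiceType}.
Implicit Types (p : T -> T -> R) (x y : T).

Definition stochastic p : Prop :=
  (forall x y, 0 <= p x y) /\
  forall x, (\esum_(y in [set: T]) (p x y)%:E = 1)%E.

Fixpoint nstep p (n : nat) x y : \bar R :=
  if n is m.+1 then (\esum_(z in [set: T]) ((p x z)%:E * nstep p m z y))%E
  else ((x == y)%:R)%:E.

Definition uniformly_irreducible p : Prop :=
  exists (eps : R) (K : nat), 0 < eps /\
    forall x y, 0 < p x y ->
      exists2 k : nat, (k <= K)%N & (eps%:E <= nstep p k x y)%E.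

(* Real arguments suffice: a real power series has the same radius of
   convergence over the reals as over the complex numbers. *)
Definition convergence_radius (a : nat -> R) : \bar R :=
  ereal_sup [set (`|z|)%:E | z in [set z : R | cvgn (pseries a z)]].

Definition green_radius p : \bar R :=
  ereal_inf [set convergence_radius (fun n => fine (nstep p n xy.1 xy.2))
            | xy in [set: T * T]].

End TransitionMatrices.

Section FreeProduct.
Variables (r : nat) (V : 'I_r -> countType) (o : forall i, V i).

(* Tagging by the factor makes the V_i disjoint. *)
Definition letter := {i : 'I_r & V i}.

Definition reduced (w : seq letter) : bool :=
  all (fun l : letter => tagged l != o (tag l)) w &&
  sorted (fun l l' : letter => tag l != tag l') w.

Definition free_product := {w : seq letter | reduced w}.

Lemma reduced_nil : reduced [::]. Proof. by []. Qed.

Definition empty_word : free_product := exist _ [::] reduced_nil.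

(* None is the type of the empty word, written 0 in the literature. *)
Definition word_type (w : seq letter) : option 'I_r :=
  if w is l :: s then Some (tag (last l s)) else None.

Definition append (u : seq letter) i (v : V i) : seq letter :=
  if v == o i then u else rcons u (Tagged V v).

(* Every reduced word x is uniquely append u v with v in V_i and u not of
   type i; prefix_part i x is u and coord i x is v. *)
Definition prefix_part i (x : seq letter) : seq letter :=
  if word_type x == Some i then take (size x).-1 x else x.

Definition coord i (x : seq letter) : V i :=
  untag (o i) id (last (Tagged V (o i)) x).

Section Walk.
Context {R : realType}.
Variables (p : forall i, V i -> V i -> R) (alpha : 'I_r -> R).

Definition lift_matrix i (x y : seq letter) : R :=
  if prefix_part i x == prefix_part i y then p (coord i x) (coord i y) else 0.

Definition free_product_matrix (x y : free_product) : R :=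
  \sum_(i < r) alpha i * lift_matrix i (val x) (val y).

End Walk.

Lemma word_type_rcons u l : word_type (rcons u l) = Some (tag l).
Proof. by case: u => //= a u; rewrite last_rcons. Qed.

Lemma prefix_part_append u i (v : V i) :
  word_type u != Some i -> prefix_part i (append u v) = u.
Proof.
move=> ui; rewrite /append /prefix_part; case: (v == o i).
  by rewrite (negPf ui).
by rewrite word_type_rcons eqxx size_rcons /= -cats1 take_size_cat.
Qed.

Lemma coord_append u i (v : V i) :
  word_type u != Some i -> coord i (append u v) = v.
Proof.
move=> ui; rewrite /append /coord; case: eqP => [->|_].
  case/lastP: u ui => [|u l] /=; first by rewrite untagE.
  rewrite word_type_rcons last_rcons => ui.
  by rewrite untag_dflt //; apply: contraNneq ui => ->.
by rewrite last_rcons untagE.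
Qed.

Lemma append_coord i x : reduced x ->
  [/\ reduced (prefix_part i x), word_type (prefix_part i x) != Some i &
      append (prefix_part i x) (coord i x) = x].
Proof.
case/lastP: x => [|u l].
  by rewrite /prefix_part /append /coord /= untagE eqxx.
rewrite /prefix_part /append /coord word_type_rcons last_rcons size_rcons /=.
have -> : take (size u) (rcons u l) = u by rewrite -cats1 take_size_cat.
move=> /[dup] red.
rewrite /reduced all_rcons => /andP[/andP[lo uo] us].
have [E|ne] := eqVneq (tag l) i; last first.
  rewrite untag_dflt // eqxx (_ : Some _ == _ = false); last first.
    by apply/negbTE; apply: contraNneq ne => -[->].
  by rewrite word_type_rcons; split=> //; apply: contraNneq ne => -[->].
case: i / E; rewrite eqxx untagE /= (negPf lo); split.
- rewrite uo /=; move: us; case: (u) => //= a s.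
  by rewrite rcons_path => /andP[].
- move: us; case: (u) => //= a s; rewrite rcons_path => /andP[_].
  by apply: contraNneq => -[->].
- by case: l {lo us red}.
Qed.

Lemma lift_matrix_append (R : realType) (p : forall i, V i -> V i -> R)
    u i (v w : V i) : word_type u != Some i ->
  lift_matrix p i (append u v) (append u w) = p i v w.
Proof.
by move=> ui; rewrite /lift_matrix !prefix_part_append // eqxx !coord_append.
Qed.

Lemma lift_matrix_neq0 (R : realType) (p : forall i, V i -> V i -> R) i x y :
  reduced x -> reduced y -> lift_matrix p i x y != 0 ->
  exists (u : seq letter) (v w : V i),
    [/\ reduced u, word_type u != Some i, x = append u v & y = append u w].
Proof.
move=> /(append_coord i)[rx tx ex] /(append_coord i)[_ _ ey].
rewrite /lift_matrix; case: (prefix_part i x =P prefix_part i y) => [exy _|];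
  last by rewrite eqxx.
by exists (prefix_part i x), (coord i x), (coord i y); split=> //; rewrite exy.
Qed.

End FreeProduct.

Section Entropy.
Context {R : realType} {d : measure_display} {Omega : measurableType d}.
Context {T : choiceType}.
Variables (Pr : probability Omega R) (X : nat -> Omega -> T).

(* Meant for a countable state space T with the discrete sigma-algebra. The
   Markov property is the conditional one, multiplied by the probability of
   the past. *)
Definition markov_chain (x0 : T) (p : T -> T -> R) : Prop :=
  [/\ forall n (A : set T), measurable (X n @^-1` A),
      (Pr (X 0%N @^-1` [set x0]) = 1)%E &
      forall n (s : nat -> T),
        (Pr [set w | forall k : nat, (k <= n.+1)%N -> X k w = s k] =
         Pr [set w | forall k : nat, (k <= n)%N -> X k w = s k]
           * (p (s n) (s n.+1))%:E)%E].

Definition law (n : nat) (x : T) : R := fine (Pr (X n @^-1` [set x])).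

Definition asymptotic_entropy : \bar R :=
  limn (fun n : nat =>
    ((n%:R^-1)%:E * 'E_Pr[fun w => (- ln (law n (X n w)))%R])%E).

End Entropy.

(* Main.v *)
Require Import Defs.
From HB Require Import structures.
From mathcomp Require Import all_boot all_order all_algebra.
From mathcomp Require Import all_classical all_reals all_analysis.
From mathcomp Require Import measurable_realfun ring lra.

Set Implicit Arguments.
Unset Strict Implicit.
Unset Printing Implicit Defensive.

Import Order.TTheory GRing.Theory Num.Theory.
Import numFieldNormedType.Exports.

Local Open Scope classical_set_scope.
Local Open Scope ring_scope.

(** Write pi_n for the law of X_n, G(x) for the Green function G(o,x|1), and
    L(y|z) for the generating function of the walks from o to the letter y that
    do not return to o. Splitting a walk at its last visits to the prefixes of
    x = x_1...x_k gives G(o,x|z) = G(o,o|z) L(x_1|z)...L(x_k|z). Hence sums such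
    as sum_n e^(eta t n) E[G(X_n)^t] are sums over reduced words of products of
    letter weights, and these are finite as soon as
    sum_i a_i / (1 + a_i) < 1, where a_i is the total weight of the letters of
    type i. At t = 0 the left-hand side is at most 1, and R > 1 makes it
    differentiable in t, so there is a number l such that the sum is finite for
    small t > 0 if eta < l and for small t < 0 if eta > l.

    For eta < l this shows that almost surely pi_n(X_n) <= G(X_n) <= e^(-eta n)
    eventually. For eta > l, Gibbs' inequality against the finite measure
    G(x) e^(-kappa |x|) and the bound on E[G(X_n)^t] give
    E[-log pi_n(X_n)] <= C + (kappa + eta) n. Fatou's lemma then forces
    liminf -log pi_n(X_n) / n = l = h almost surely. *)

(** * Sums of nonnegative families *)

(** The value at t = 0 is bounded by a probabilistic argument. There a_k is the expected number of
    visits to letters of type k before returning to o. If d_k is the probability of leaving o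
    through factor k for ever, then a_k * sum_{j != k} d_j <= d_k, that is a_k / (1 + a_k) <= d_k /
    sum_j d_j. Summing over k gives only the weak inequality <= 1: the untilted sum over words sits
    at the boundary of the criterion, which is why G has to be damped by e^(-kappa |x|) before it
    can serve as a finite reference measure. The slope in t needs exponential moments of a_k, sums
    over possibly infinitely many letters which R > 1 does not bound directly. They come from
    balance equations that form a renewal equation with kernel of mass less than one. The logarithms
    log L(y|1) are integrated against the same moments: uniform irreducibility bounds them by C (n +
    1) when y is reachable in n steps avoiding o. Derivatives are replaced by one-sided second-order
    bounds on nonnegative sums. Convergence of the expectations defining h is not assumed; it
    results from the same two bounds that identify the lower limit. *)

Section EsumExtra.
Context {R : realType}.
Local Open Scope ereal_scope.

Lemma esum_term_le (T : choiceType) (f : T -> \bar R) x :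
  (forall y, 0 <= f y) -> f x <= \esum_(y in [set: T]) f y.
Proof.
move=> f0; apply: esum_ge; exists [set x] => //.
by rewrite fsbig_set1.
Qed.

(** Finite subsums give one inequality; the same inequality for the factor [c^-1] gives the other.
    An infinite [c] is treated apart, since it has no inverse. *)
Lemma esumZl (T : choiceType) (c : \bar R) (f : T -> \bar R) :
  0 <= c -> (forall y, 0 <= f y) ->
  \esum_(y in [set: T]) (c * f y) = c * \esum_(y in [set: T]) f y.
Proof.
have le_Z (c' : \bar R) (g : T -> \bar R) : 0 <= c' -> (forall y, 0 <= g y) ->
    \esum_(y in [set: T]) (c' * g y) <= c' * \esum_(y in [set: T]) g y.
  move=> c0 g0; apply: ge_ereal_sup => _ [F [finF FT] <-].
  rewrite fsbig_finite//= -ge0_sume_distrr//; apply: lee_wpmul2l => //.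
  by apply: esum_ge; exists F => //; rewrite fsbig_finite.
move=> c0 f0; apply/eqP; rewrite eq_le le_Z//=.
have [->|cn0] := eqVneq c 0.
  by rewrite mul0e; apply: esum_ge0 => y _; rewrite mul0e.
have cp : 0 < c by rewrite lt_def cn0.
case: c c0 cn0 cp => [r r0 _ rp|_ _ _|//].
  rewrite -[leRHS]mul1e.
  have <- : r%:E * r^-1%:E = 1 by rewrite -EFinM divff// gt_eqF// -lte_fin.
  rewrite -muleA; apply: lee_wpmul2l => //.
  apply: le_trans (le_Z _ _ _ _); last 2 first.
  - by rewrite lee_fin invr_ge0 -lee_fin.
  - by move=> y; rewrite mule_ge0.
  apply: le_esum => y _; rewrite muleA -EFinM mulVf ?mul1e//.
  by rewrite gt_eqF// -lte_fin.
have [allf|/existsNP[x /eqP fx]] := pselect (forall y, f y = 0).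
  by rewrite esum1 ?mule0//; apply: esum_ge0 => y _; rewrite mule_ge0.
apply: le_trans (esum_term_le x _); last by move=> y; rewrite mule_ge0.
by rewrite [leRHS]gt0_mulye ?leey// lt_def fx f0.
Qed.

Lemma esumZr (T : choiceType) (c : \bar R) (f : T -> \bar R) :
  0 <= c -> (forall y, 0 <= f y) ->
  \esum_(y in [set: T]) (f y * c) = (\esum_(y in [set: T]) f y) * c.
Proof.
move=> c0 f0; rewrite [RHS]muleC -esumZl//.
by apply: eq_esum => y _; rewrite muleC.
Qed.

Lemma esum_swap (T U : choiceType) (f : T -> U -> \bar R) :
  (forall x y, 0 <= f x y) ->
  \esum_(x in [set: T]) \esum_(y in [set: U]) f x y =
  \esum_(y in [set: U]) \esum_(x in [set: T]) f x y.
Proof.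
move=> f0; rewrite (esum_esum (J := fun=> setT))//.
rewrite (esum_esum (J := fun=> setT))//.
apply: (reindex_esum _ _ (fun z => (z.2, z.1))); split=> //.
  by move=> [x y] [x' y'] _ _ [-> ->].
by move=> [x y] _; exists (y, x).
Qed.

Lemma esum_pair (T U : choiceType) (f : T -> U -> \bar R) :
  (forall x y, 0 <= f x y) ->
  \esum_(x in [set: T]) \esum_(y in [set: U]) f x y =
  \esum_(z in [set: T * U]) f z.1 z.2.
Proof.
move=> f0; rewrite (esum_esum (J := fun=> setT))//; congr esum.
by apply/seteqP; split.
Qed.

Lemma esum_remove (T : choiceType) (f : T -> \bar R) x :
  (forall y, 0 <= f y) ->
  \esum_(y in [set: T]) f y =
  f x + \esum_(y in [set: T]) (if y == x then 0 else f y).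
Proof.
move=> f0; rewrite (esumID [set x])// !setTI esum_set1//; congr (_ + _).
rewrite esum_mkcond; apply: eq_esum => y _.
by rewrite in_setC in_set1; case: (y == x).
Qed.

Lemma esum_delta (T : choiceType) (f : T -> \bar R) x :
  (forall y, 0 <= f y) -> (forall y, y != x -> f y = 0) ->
  \esum_(y in [set: T]) f y = f x.
Proof.
move=> f0 fx; rewrite (esum_remove x)// esum1 ?adde0// => y _.
by case: eqVneq => // /fx.
Qed.

Lemma esum_inj (T U : choiceType) (e : T -> U) (f : U -> \bar R) :
  injective e -> (forall y, 0 <= f y) ->
  (forall y, ~ (exists x, y = e x) -> f y = 0) ->
  \esum_(y in [set: U]) f y = \esum_(x in [set: T]) f (e x).
Proof.
move=> einj f0 fe; rewrite -(esum_image setT e); last by move=> ? ? _ _ /einj.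
rewrite [RHS]esum_mkcond; apply: eq_esum => y _.
case: ifPn => //; rewrite notin_setE => ny.
by apply: fe => -[x yx]; apply: ny; exists x.
Qed.

Lemma esum_inj_le (T U : choiceType) (e : T -> U) (f : U -> \bar R) :
  injective e -> (forall y, 0 <= f y) ->
  \esum_(x in [set: T]) f (e x) <= \esum_(y in [set: U]) f y.
Proof.
move=> einj f0; rewrite -(esum_image setT e); last by move=> ? ? _ _ /einj.
by rewrite esum_mkcond; apply: le_esum => y _; case: ifP.
Qed.

Lemma esum_seq_cons (T : choiceType) (f : seq T -> \bar R) :
  (forall s, 0 <= f s) ->
  \esum_(s in [set: seq T]) f s =
  f [::] + \esum_(y in [set: T]) \esum_(s in [set: seq T]) f (y :: s).
Proof.
move=> f0; rewrite (esum_remove [::])//; congr (_ + _).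
rewrite (esum_pair (f := fun y s => f (y :: s)))//.
rewrite (esum_inj (e := fun z => z.1 :: z.2)) //.
- by move=> [x s] [y t] [-> ->].
- by move=> s; case: ifP.
- by case=> [|y s] // ns; case: ns; exists (y, s).
Qed.

Lemma esum_tagged (n : nat) (V : 'I_n -> choiceType)
    (f : {i : 'I_n & V i} -> \bar R) :
  (forall y, 0 <= f y) ->
  \esum_(y in [set: {i : 'I_n & V i}]) f y =
  \sum_(i < n) \esum_(c in [set: V i]) f (Tagged V c).
Proof.
move=> f0.
rewrite (eq_esum (b := fun y => \sum_(i < n) if tag y == i then f y else 0)).
  rewrite esum_sum; last by move=> ? ? _ _; case: ifP.
  apply: eq_bigr => i _; rewrite (esum_inj (e := fun c : V i => Tagged V c)).
  - by apply: eq_esum => c _; rewrite eqxx.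
  - by move=> c c' /eqP; rewrite eq_Tagged => /eqP.
  - by move=> y; case: ifP.
  - move=> [j c] ny; case: eqP => //= ji; case: ny.
    by case: i / ji; exists c.
move=> y _; rewrite (bigD1 (tag y))//= eqxx big1 ?adde0// => i.
by rewrite eq_sym => /negPf ->.
Qed.

(** Extending the inner sum by zero beyond [k <= n] makes it a double sum over all pairs; after
    swapping, the shift [n = k + m] separates the factors. *)
Lemma esum_cauchy (f g : nat -> \bar R) :
  (forall n, 0 <= f n) -> (forall n, 0 <= g n) ->
  \esum_(n in [set: nat]) \sum_(k < n.+1) f k * g (n - k)%N =
  (\esum_(n in [set: nat]) f n) * (\esum_(n in [set: nat]) g n).
Proof.
move=> f0 g0.
pose h k n := if (k <= n)%N then f k * g (n - k)%N else 0.
have h0 k n : 0 <= h k n by rewrite /h; case: ifP => // _; rewrite mule_ge0.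
rewrite -esumZr//; last exact: esum_ge0.
rewrite (eq_esum (b := fun n => \esum_(k in [set: nat]) h k n)); last first.
  move=> n _; rewrite -nneseries_esumT//.
  rewrite (nneseries_split 0 n.+1)// add0n big_mkord.
  rewrite eseries0 ?adde0; last by move=> i ni _; rewrite /h leqNgt ni.
  by apply: eq_bigr => k _; rewrite /h -ltnS ltn_ord.
rewrite esum_swap//; apply: eq_esum => k _.
rewrite (esum_inj (e := fun m => k + m)%N)//.
- rewrite -esumZl//; apply: eq_esum => m _.
  by rewrite /h leq_addr addKn.
- exact: addnI.
- move=> n nk; rewrite /h; case: ifP => // kn; case: nk.
  by exists (n - k)%N; rewrite subnKC.
Qed.

End EsumExtra.

(** * Transition matrices and words *)

Section NStep.
Context {R : realType} {T : choiceType}.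
Variable p : T -> T -> R.
Hypothesis p0 : forall x y, 0 <= p x y.
Local Open Scope ereal_scope.

Let pE0 x y : 0 <= (p x y)%:E. Proof. by rewrite lee_fin. Qed.

Lemma nstep_ge0 n x y : 0 <= nstep p n x y.
Proof.
elim: n x y => [|n IH] x y /=; first by rewrite lee_fin.
by apply: esum_ge0 => z _; rewrite mule_ge0.
Qed.

Let n0 := nstep_ge0.

Lemma nstep_add m n x y :
  nstep p (m + n) x y = \esum_(z in [set: T]) (nstep p m x z * nstep p n z y).
Proof.
elim: m x y => [|m IH] x y /=.
  rewrite (esum_delta (x := x)) ?eqxx ?mul1e//.
    by move=> z; rewrite mule_ge0 ?lee_fin.
  by move=> z zx; rewrite eq_sym (negPf zx) mul0e.
transitivity (\esum_(u in [set: T]) \esum_(z in [set: T])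
    ((p x u)%:E * (nstep p m u z * nstep p n z y))).
  apply: eq_esum => u _; rewrite IH esumZl// => z.
  by rewrite mule_ge0.
rewrite esum_swap; last by move=> ? ?; rewrite !mule_ge0.
apply: eq_esum => z _.
rewrite -esumZr//; first by apply: eq_esum => u _; rewrite muleA.
by move=> u; rewrite mule_ge0.
Qed.

Lemma nstep1 x y : nstep p 1 x y = (p x y)%:E.
Proof.
rewrite /= (esum_delta (x := y)) ?eqxx ?mule1//.
  by move=> z; rewrite mule_ge0 ?lee_fin.
by move=> z /negPf ->; rewrite mule0.
Qed.

Lemma nstepSr n x y :
  nstep p n.+1 x y = \esum_(z in [set: T]) (nstep p n x z * (p z y)%:E).
Proof. by rewrite -addn1 nstep_add; apply: eq_esum => z _; rewrite nstep1. Qed.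

Lemma nstep_add_ge m n x y z :
  nstep p m x z * nstep p n z y <= nstep p (m + n) x y.
Proof.
rewrite nstep_add.
apply: (@esum_term_le _ _ (fun z => nstep p m x z * nstep p n z y)) => u.
by rewrite mule_ge0.
Qed.

Lemma nstep_mass n x :
  (forall x, \esum_(y in [set: T]) (p x y)%:E = 1) ->
  \esum_(y in [set: T]) nstep p n x y = 1.
Proof.
move=> p1; elim: n x => [|n IH] x.
  rewrite (esum_delta (x := x)) /= ?eqxx//.
  by move=> z zx; rewrite eq_sym (negPf zx).
rewrite /= esum_swap; last by move=> ? ?; rewrite mule_ge0.
rewrite -(p1 x); apply: eq_esum => z _.
by rewrite esumZl// IH mule1.
Qed.

(** Each edge of a path of positive probability is replaced by a detour of probability at least [c].
    The length [k] of the resulting path is uncontrolled, which is harmless for a bound on the Green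
    function at 1. *)
Lemma nstep_lower (c : R) : (0 <= c)%R ->
  (forall x y, (0 < p x y)%R -> exists k, c%:E <= nstep p k x y) ->
  forall n x y, 0 < nstep p n x y ->
  exists k, (c ^+ n)%:E <= nstep p k x y.
Proof.
move=> c0 pc; elim=> [|n IH] x y /=.
  rewrite lte_fin => xy; exists 0%N => /=; rewrite expr0 lee_fin.
  by move: xy; case: (x == y); rewrite ?ltxx.
move=> pos.
have [z zpos] : exists z, 0 < (p x z)%:E * nstep p n z y.
  apply: contrapT => /forallNP h; move: pos; rewrite esum1 ?ltxx// => z _.
  apply/eqP; rewrite eq_le mule_ge0// andbT leNgt; apply/negP; exact: h.
have pxz : (0 < p x z)%R.
  rewrite lt_def p0 andbT; apply: contraTneq zpos => ->.
  by rewrite mul0e ltxx.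
have nzy : 0 < nstep p n z y.
  rewrite lt_def n0 andbT; apply: contraTneq zpos => ->.
  by rewrite mule0 ltxx.
have [k kc] := pc _ _ pxz; have [m mc] := IH _ _ nzy.
exists (k + m)%N; apply: le_trans (nstep_add_ge _ _ _ _ z).
by rewrite exprS EFinM lee_pmul// lee_fin// exprn_ge0.
Qed.

End NStep.

(** * Visit probabilities on words and their splitting along cones *)

Section Words.
Context {R : realType} {r : nat} {V : 'I_r -> countType}.
Variables (o : forall i, V i) (p : forall i, V i -> V i -> R).
Variable alpha : 'I_r -> R.
Hypothesis p0 : forall i (x y : V i), 0 <= p x y.
Hypothesis alpha0 : forall i, 0 <= alpha i.
Implicit Types (u v w x : seq (letter V)).

Let pE0 i (x y : V i) : (0 <= (p x y)%:E)%E. Proof. by rewrite lee_fin. Qed.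
Let aE0 i : (0 <= (alpha i)%:E)%E. Proof. by rewrite lee_fin. Qed.

Lemma reduced_rcons u l :
  reduced o (rcons u l) =
  [&& reduced o u, tagged l != o (tag l) & word_type u != Some (tag l)].
Proof.
rewrite /reduced all_rcons.
case: u => [|a u] /=; first by rewrite !andbT.
rewrite rcons_path.
have -> : (Some (tag (last a u)) != Some (tag l)) = (tag (last a u) != tag l).
  by [].
by move: (tagged l != _) (tagged a != _) (all _ _) (path _ _ _)
  (tag (last a u) != _) => [] [] [] [] [].
Qed.

Lemma reduced_append u i (c : V i) :
  reduced o u -> word_type u != Some i -> reduced o (append o u c).
Proof.
move=> ru tu; rewrite /append; case: eqVneq => // co.
by rewrite reduced_rcons ru tu co.
Qed.

Lemma append_inj u i : injective (fun c : V i => append o u c).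
Proof.
move=> c d; rewrite /append; case: eqVneq => [->|co]; case: eqVneq => [->|d'] //.
- by move=> /(congr1 size)/eqP; rewrite size_rcons -[X in X == _]addn0 -addn1 eqn_add2l.
- by move=> /(congr1 size)/eqP; rewrite size_rcons -[X in _ == X]addn0 -addn1 eqn_add2l.
- by move=> /rcons_inj/(congr1 snd)/= /eqP; rewrite eq_Tagged => /eqP.
Qed.

Lemma append_cat x u i (c : V i) : append o (x ++ u) c = x ++ append o u c.
Proof. by rewrite /append; case: ifP; rewrite ?rcons_cat. Qed.

Lemma prefix_part_rcons u l i :
  prefix_part i (rcons u l) = if tag l == i then u else rcons u l.
Proof.
rewrite /prefix_part word_type_rcons (_ : (Some _ == Some _) = (tag l == i))//.
by case: ifP => // _; rewrite size_rcons /= -cats1 take_size_cat.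
Qed.

Lemma coord_rcons u l i : Defs.coord o i (rcons u l) = untag (o i) id l.
Proof. by rewrite /Defs.coord last_rcons. Qed.

Lemma prefix_part_cat x v i :
  v != [::] -> prefix_part i (x ++ v) = x ++ prefix_part i v.
Proof.
case/lastP: v => // v l _; rewrite -rcons_cat !prefix_part_rcons.
by case: ifP; rewrite ?rcons_cat.
Qed.

Lemma coord_cat x v i : v != [::] -> Defs.coord o i (x ++ v) = Defs.coord o i v.
Proof. by case/lastP: v => // v l _; rewrite -rcons_cat !coord_rcons. Qed.

Local Open Scope ereal_scope.

(** The action of P on row vectors: a predecessor of [x] through factor i differs from [x] only in
    its [V i]-coordinate. It is written on arbitrary words, so that cutting a word into [x ++ v]
    carries no proof of reducedness. *)
Definition word_step (f : seq (letter V) -> \bar R) x : \bar R :=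
  \sum_(i < r) (alpha i)%:E *
    \esum_(c in [set: V i])
      (f (append o (prefix_part i x) c) * (p c (Defs.coord o i x))%:E).

Lemma word_step_ge0 f x : (forall y, 0 <= f y) -> 0 <= word_step f x.
Proof.
move=> f0; apply: sume_ge0 => i _; rewrite mule_ge0// esum_ge0// => c _.
by rewrite mule_ge0.
Qed.

(* Probability to be at x at time n, extended to all words by the same
   recursion; taboo is the probability that moreover the empty word is not
   revisited. *)
Fixpoint visit n x : \bar R :=
  if n is m.+1 then word_step (visit m) x else ((x == [::])%:R)%:E.

Fixpoint taboo n x : \bar R :=
  if n is m.+1 then (if x is [::] then 0 else word_step (taboo m) x)
  else ((x == [::])%:R)%:E.

Lemma visit_ge0 n x : 0 <= visit n x.
Proof.
elim: n x => [|n IH] x /=; first by rewrite lee_fin.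
exact: word_step_ge0.
Qed.

Lemma taboo_ge0 n x : 0 <= taboo n x.
Proof.
elim: n x => [|n IH] x /=; first by rewrite lee_fin.
by case: x => // l x; exact: word_step_ge0.
Qed.

Let v0 := visit_ge0.
Let t0 := taboo_ge0.

Lemma taboo_nil n : taboo n [::] = ((n == 0%N)%:R)%:E.
Proof. by case: n. Qed.

(* A walk ending in the cone of x splits at its last visit to x. *)
Lemma cone_split (f : nat -> seq (letter V) -> \bar R) x :
  (forall n w, 0 <= f n w) ->
  (forall v, v != [::] -> f 0%N (x ++ v) = 0) ->
  (forall n v, v != [::] -> f n.+1 (x ++ v) = word_step (f n) (x ++ v)) ->
  forall n v, f n (x ++ v) = \sum_(k < n.+1) f k x * taboo (n - k)%N v.
Proof.
move=> f0 fx0 fxS.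
have nil n : f n (x ++ [::]) = \sum_(k < n.+1) f k x * taboo (n - k)%N [::].
  rewrite cats0 big_ord_recr /= subnn /= mule1 big1 ?add0e// => k _.
  by rewrite taboo_nil subn_eq0 leqNgt ltn_ord mule0.
elim=> [|n IH] v; have [->|vn] := eqVneq v [::]; do ?exact: nil.
  by rewrite big_ord_recr big_ord0 /= (negPf vn) mule0 add0e fx0.
(* The term [k = n.+1] vanishes: in zero steps the nonempty [v] is not reached. *)
rewrite big_ord_recr /= subnn /= (negPf vn) mule0 adde0 fxS//.
transitivity (\sum_(k < n.+1) f k x * word_step (taboo (n - k)) v);
  last first.
  apply: eq_bigr => k _; rewrite subSn ?leq_ord//=.
  by case: (v) vn.
transitivity (\sum_(k < n.+1) \sum_(i < r) (alpha i)%:E * (f k x *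
    \esum_(c in [set: V i]) (taboo (n - k) (append o (prefix_part i v) c) *
      (p c (Defs.coord o i v))%:E))); last first.
  apply: eq_bigr => k _; rewrite /word_step ge0_sume_distrr.
    by apply: eq_bigr => i _; rewrite muleCA.
  by move=> i _; rewrite mule_ge0// esum_ge0// => c _; rewrite mule_ge0.
rewrite exchange_big /=; apply: eq_bigr => i _.
rewrite -ge0_sume_distrr; last first.
  by move=> k _; rewrite mule_ge0 ?esum_ge0// => c _; rewrite mule_ge0.
congr (_ * _).
transitivity (\sum_(k < n.+1) \esum_(c in [set: V i]) (f k x *
    (taboo (n - k) (append o (prefix_part i v) c) *
      (p c (Defs.coord o i v))%:E))); last first.
  by apply: eq_bigr => k _; rewrite esumZl// => c; rewrite mule_ge0.
rewrite -esum_sum; last by move=> *; rewrite !mule_ge0.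
(* For nonempty [v] a step into [x ++ v] reads and changes only [v], so every predecessor again lies
   in the cone of [x] and the induction hypothesis applies. *)
apply: eq_esum => c _; rewrite prefix_part_cat// coord_cat// append_cat IH.
rewrite ge0_sume_distrl; last by move=> k _; rewrite mule_ge0.
by apply: eq_bigr => k _; rewrite muleA.
Qed.

Lemma visit_cat n x v :
  visit n (x ++ v) = \sum_(k < n.+1) visit k x * taboo (n - k)%N v.
Proof.
apply: cone_split => // w wn /=.
by rewrite -size_eq0 size_cat addn_eq0 [size w == _]size_eq0 (negPf wn) andbF.
Qed.

Lemma taboo_cat n x v :
  taboo n (x ++ v) = \sum_(k < n.+1) taboo k x * taboo (n - k)%N v.
Proof.
apply: cone_split => // [w wn /=|m w wn /=].
  by rewrite -size_eq0 size_cat addn_eq0 [size w == _]size_eq0 (negPf wn) andbF.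
by case: (x) => //=; case: (w) wn.
Qed.

(** This is the term [k = 0] of [visit_cat] with empty prefix, where [visit 0 [::] = 1]. *)
Lemma taboo_le_visit n v : taboo n v <= visit n v.
Proof.
rewrite -[v in leRHS]cat0s visit_cat big_ord_recl /= mul1e subn0.
by apply: leeDl; apply: sume_ge0 => k _; rewrite mule_ge0// word_step_ge0.
Qed.

End Words.

(** * The walk on the free product *)

Section WordsFreeProduct.
Context {R : realType} {r : nat} {V : 'I_r -> countType}.
Variables (o : forall i, V i) (p : forall i, V i -> V i -> R).
Variable alpha : 'I_r -> R.
Hypothesis p0 : forall i (x y : V i), 0 <= p x y.
Hypothesis p1 : forall i (x : V i), (\esum_(y in [set: V i]) (p x y)%:E = 1)%E.
Hypothesis alpha0 : forall i, 0 <= alpha i.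
Hypothesis alpha1 : \sum_(i < r) alpha i = 1.

Let pE0 i (x y : V i) : (0 <= (p x y)%:E)%E. Proof. by rewrite lee_fin. Qed.
Let aE0 i : (0 <= (alpha i)%:E)%E. Proof. by rewrite lee_fin. Qed.

Local Notation P := (free_product_matrix (o := o) p alpha).
Local Notation step := (word_step o p alpha).
Local Notation visit := (visit o p alpha).
Local Notation taboo := (taboo o p alpha).

Let v0 := visit_ge0 o p0 alpha0.
Let t0 := taboo_ge0 o p0 alpha0.

Local Open Scope ereal_scope.

Lemma lift_matrix_ge0 i u v : (0 <= lift_matrix o p i u v)%R.
Proof. by rewrite /lift_matrix; case: ifP. Qed.

Lemma free_product_matrix_ge0 u v : (0 <= P u v)%R.
Proof.
by apply: sumr_ge0 => i _; rewrite mulr_ge0// lift_matrix_ge0.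
Qed.

Let Pl0 := free_product_matrix_ge0.

(** Parametrizes the copy of [V i] through [x]. As the lift of [p i] vanishes between different
    copies, sums over the free product against it reduce to sums over [V i]. *)
Definition neighbour i (x : free_product o) (c : V i) : free_product o :=
  let: And3 rx tx _ := append_coord i (valP x) in
  exist _ (append o (prefix_part i (val x)) c) (reduced_append c rx tx).

Lemma val_neighbour i x (c : V i) :
  val (neighbour x c) = append o (prefix_part i (val x)) c.
Proof. by rewrite /neighbour; case: append_coord. Qed.

Lemma neighbour_inj i x : injective (@neighbour i x).
Proof.
by move=> c d /(congr1 val); rewrite !val_neighbour => /append_inj.
Qed.

Lemma esum_lift_matrix i x (F : free_product o -> \bar R) :
  (forall u, 0 <= F u) ->
  (forall u, prefix_part i (val u) != prefix_part i (val x) -> F u = 0) ->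
  \esum_(u in [set: free_product o]) F u =
  \esum_(c in [set: V i]) F (neighbour x c).
Proof.
move=> F0 Fx; apply: esum_inj => //; first exact: neighbour_inj.
move=> u nu; apply: Fx; apply: contra_notN nu => /eqP ux.
exists (Defs.coord o i (val u)); apply: val_inj; rewrite val_neighbour -ux.
by have [_ _ ->] := append_coord i (valP u).
Qed.

Lemma prefix_part_neighbour i x (c : V i) :
  prefix_part i (val (neighbour x c)) = prefix_part i (val x).
Proof.
rewrite val_neighbour prefix_part_append//.
by have [] := append_coord i (valP x).
Qed.

Lemma coord_neighbour i x (c : V i) : Defs.coord o i (val (neighbour x c)) = c.
Proof.
rewrite val_neighbour coord_append//.
by have [] := append_coord i (valP x).
Qed.

Lemma esum_word_step (f : seq (letter V) -> \bar R) (x : free_product o) :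
  (forall u, 0 <= f u) ->
  \esum_(u in [set: free_product o]) (f (val u) * (P u x)%:E) =
  step f (val x).
Proof.
move=> f0.
transitivity (\esum_(u in [set: free_product o]) \sum_(i < r)
   (alpha i)%:E * (f (val u) * (lift_matrix o p i (val u) (val x))%:E)).
  apply: eq_esum => u _; rewrite /free_product_matrix -sumEFin.
  rewrite ge0_sume_distrr; last first.
    by move=> i _; rewrite lee_fin mulr_ge0// lift_matrix_ge0.
  by apply: eq_bigr => i _; rewrite EFinM muleCA.
rewrite esum_sum; last first.
  by move=> u i _ _; rewrite !mule_ge0// lee_fin lift_matrix_ge0.
apply: eq_bigr => i _; rewrite esumZl//; last first.
  by move=> u; rewrite mule_ge0// lee_fin lift_matrix_ge0.
congr (_ * _); rewrite (esum_lift_matrix (i := i) (x := x)).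
- apply: eq_esum => c _; rewrite -val_neighbour; congr (_ * _%:E).
  by rewrite /lift_matrix prefix_part_neighbour eqxx coord_neighbour.
- by move=> u; rewrite mule_ge0// lee_fin lift_matrix_ge0.
- by move=> u; rewrite /lift_matrix => /negPf ->; rewrite mule0.
Qed.

Lemma nstep_visit n x : nstep P n (empty_word o) x = visit n (val x).
Proof.
elim: n x => [|n IH] x; first by rewrite /= -val_eqE eq_sym.
rewrite nstepSr// [RHS]/= -esum_word_step//.
by apply: eq_esum => u _; rewrite IH.
Qed.

Lemma free_product_matrix_mass x :
  \esum_(y in [set: free_product o]) (P x y)%:E = 1.
Proof.
transitivity (\esum_(y in [set: free_product o]) \sum_(i < r)
   (alpha i)%:E * ((lift_matrix o p i (val x) (val y))%:E)).
  by apply: eq_esum => y _; rewrite /free_product_matrix -sumEFin.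
rewrite esum_sum; last first.
  by move=> u i _ _; rewrite !mule_ge0// lee_fin lift_matrix_ge0.
rewrite -alpha1 -sumEFin; apply: eq_bigr => i _.
rewrite esumZl//; last by move=> u; rewrite lee_fin lift_matrix_ge0.
rewrite -[RHS]mule1; congr (_ * _); rewrite -(p1 (Defs.coord o i (val x))).
rewrite (esum_lift_matrix (i := i) (x := x)).
- apply: eq_esum => c _; congr (_%:E).
  by rewrite /lift_matrix prefix_part_neighbour eqxx coord_neighbour.
- by move=> u; rewrite lee_fin lift_matrix_ge0.
- by move=> u; rewrite /lift_matrix eq_sym => /negPf ->.
Qed.

Lemma visit_mass n :
  \esum_(x in [set: free_product o]) visit n (val x) = 1.
Proof.
rewrite -(nstep_mass Pl0 n (empty_word o) free_product_matrix_mass).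
by apply: eq_esum => x _; rewrite nstep_visit.
Qed.

Lemma visit_le1 n (x : free_product o) : visit n (val x) <= 1.
Proof. by rewrite -(visit_mass n); apply: (esum_term_le x) => y. Qed.

Lemma append_nil_mass i n :
  \esum_(c in [set: V i]) taboo n (append o [::] c) <= 1.
Proof.
rewrite -(visit_mass n).
apply: le_trans (esum_inj_le (@neighbour_inj i (empty_word o)) _) => //.
apply: le_esum => c _; rewrite val_neighbour/=.
exact: taboo_le_visit.
Qed.

(** Probability that the walk is at a letter of type k at time n without having returned to o; its
    sum over n is the untilted letter weight a_k. *)
Definition level k n : \bar R :=
  \esum_(c in [set: V k]) (if c == o k then 0 else taboo n [:: Tagged V c]).

(** First-return probability at time [n.+1], not [n], by a last step in factor j. By the cone
    structure it also governs excursions from any word not of type j into its factor j. *)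
Definition return_via j n : \bar R :=
  (alpha j)%:E *
  \esum_(c in [set: V j]) (taboo n (append o [::] c) * (p c (o j))%:E).

Lemma level_ge0 k n : 0 <= level k n.
Proof. by apply: esum_ge0 => c _; case: ifP. Qed.

Lemma return_via_ge0 j n : 0 <= return_via j n.
Proof. by rewrite mule_ge0// esum_ge0// => c _; rewrite mule_ge0. Qed.

Let l0 := level_ge0.
Let u0 := return_via_ge0.

Lemma append_nil_level k n :
  \esum_(c in [set: V k]) taboo n (append o [::] c) =
  ((n == 0%N)%:R)%:E + level k n.
Proof.
rewrite (esum_remove (o k))// {1}/append eqxx taboo_nil; congr (_ + _).
by apply: eq_esum => c _; rewrite /append; case: eqVneq.
Qed.

Lemma level_le1 k n : level k n <= 1.
Proof.
apply: le_trans (append_nil_mass k n); rewrite append_nil_level.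
by rewrite leeDr// lee_fin.
Qed.

Lemma level0 k : level k 0 = 0.
Proof. by apply: esum1 => c _; case: ifP. Qed.

Lemma p_le1 i (x y : V i) : (p x y <= 1)%R.
Proof.
rewrite -lee_fin -(p1 x).
by apply: (@esum_term_le _ _ (fun y => (p x y)%:E)) => z.
Qed.

Lemma alpha_le1 i : (alpha i <= 1)%R.
Proof. by rewrite -alpha1 (bigD1 i)//= lerDl sumr_ge0. Qed.

Lemma return_via_le1 j n : return_via j n <= 1.
Proof.
rewrite -[leRHS]mule1 lee_pmul ?lee_fin ?alpha_le1//.
  by apply: esum_ge0 => c _; rewrite mule_ge0.
apply: le_trans (append_nil_mass j n); apply: le_esum => c _.
by rewrite -[leRHS]mule1 lee_pmul// lee_fin p_le1.
Qed.

(** The last step into [c] either moves inside the copy of [V k] at the root, or closes an excursion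
    from [c] through another factor j; [taboo_cat] cuts the latter at the preceding visit to [c], at
    time m. *)
Lemma taboo_letterS k n (c : V k) : c != o k ->
  taboo n.+1 [:: Tagged V c] =
  (alpha k)%:E * (\esum_(e in [set: V k])
    (taboo n (append o [::] e) * (p e c)%:E)) +
  \sum_(j < r | j != k) \sum_(m < n.+1)
    taboo m [:: Tagged V c] * return_via j (n - m).
Proof.
move=> ck; rewrite [LHS]/= [LHS]/word_step [LHS](bigD1 k)//=; congr (_ + _).
  congr (_ * _); apply: eq_esum => e _.
  rewrite -[[:: _]]/(rcons [::] (Tagged V c)) prefix_part_rcons eqxx.
  by rewrite coord_rcons untagE.
apply: eq_bigr => j jk.
rewrite -[[:: _]]/(rcons [::] (Tagged V c)) prefix_part_rcons eq_sym (negPf jk).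
rewrite coord_rcons untag_dflt; last by rewrite /= eq_sym.
rewrite /return_via.
under eq_bigr do rewrite muleCA.
rewrite -ge0_sume_distrr; last first.
  by move=> m _; rewrite mule_ge0// esum_ge0// => d _; rewrite mule_ge0.
congr (_ * _).
transitivity (\sum_(m < n.+1) \esum_(d in [set: V j])
    (taboo m [:: Tagged V c] *
      (taboo (n - m) (append o [::] d) * (p d (o j))%:E))); last first.
  by apply: eq_bigr => m _; rewrite esumZl// => d; rewrite mule_ge0.
rewrite -esum_sum; last by move=> *; rewrite !mule_ge0.
apply: eq_esum => d _; rewrite -(cats0 (rcons _ _)) append_cat taboo_cat//.
rewrite ge0_sume_distrl; last by move=> m _; rewrite mule_ge0.
by apply: eq_bigr => m _; rewrite muleA.
Qed.

(** Conservation of mass in the root copy of [V k]: summing [taboo_letterS] over the letters and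
    adding the flow back to o completes the rows of [p k] to mass 1. *)
Lemma level_balance k n :
  level k n.+1 + return_via k n =
  (alpha k)%:E * (((n == 0%N)%:R)%:E + level k n) +
  \sum_(j < r | j != k) \sum_(m < n.+1) level k m * return_via j (n - m).
Proof.
(* Unlike the summands of [level], [A] is kept at [c = o k] as well, where it equals
   [return_via k n]. *)
pose A c := (alpha k)%:E * \esum_(e in [set: V k])
    (taboo n (append o [::] e) * (p e c)%:E).
have A0 c : 0 <= A c.
  by rewrite mule_ge0// esum_ge0// => e _; rewrite mule_ge0.
have -> : level k n.+1 = (\esum_(c in [set: V k]) (if c == o k then 0 else A c))
    + \sum_(j < r | j != k) \sum_(m < n.+1) level k m * return_via j (n - m).
  transitivity (\esum_(c in [set: V k]) ((if c == o k then 0 else A c) +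
     \sum_(j < r | j != k) \sum_(m < n.+1)
     (if c == o k then 0 else taboo m [:: Tagged V c]) * return_via j (n - m))).
    apply: eq_esum => c _; case: eqVneq => [_|ck].
      by rewrite big1 ?adde0// => j _; rewrite big1// => m _; rewrite mul0e.
    exact: taboo_letterS.
  rewrite esumD; last 2 first.
  - by move=> c _; case: ifP.
  - move=> c _; apply: sume_ge0 => j _; apply: sume_ge0 => m _.
    by rewrite mule_ge0//; case: ifP.
  congr (_ + _).
  rewrite esum_sum; last first.
    move=> c j _ _; apply: sume_ge0 => m _.
    by rewrite mule_ge0//; case: ifP.
  apply: eq_bigr => j _; rewrite esum_sum; last first.
    by move=> c m _ _; rewrite mule_ge0//; case: ifP.
  by apply: eq_bigr => m _; rewrite esumZr// => c; case: ifP.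
rewrite addeAC; congr (_ + _).
rewrite addeC -[return_via k n]/(A (o k)) -esum_remove// /A.
rewrite esumZl//; last by move=> c; rewrite esum_ge0// => e _; rewrite mule_ge0.
congr (_ * _); rewrite -append_nil_level esum_swap; last first.
  by move=> *; rewrite mule_ge0.
by apply: eq_esum => e _; rewrite esumZl// p1 mule1.
Qed.

(** Renewal equation of the returns to o, cut at the last earlier visit at time m. *)
Lemma visit_nilS n :
  visit n.+1 [::] =
  \sum_(m < n.+1) visit m [::] * \sum_(j < r) return_via j (n - m).
Proof.
rewrite [LHS]/= /word_step.
under [RHS]eq_bigr do rewrite ge0_sume_distrr//.
rewrite exchange_big/=; apply: eq_bigr => j _; rewrite /return_via.
under [RHS]eq_bigr do rewrite muleCA.
rewrite -ge0_sume_distrr; last first.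
  by move=> m _; rewrite mule_ge0// esum_ge0// => d _; rewrite mule_ge0.
congr (_ * _).
transitivity (\sum_(m < n.+1) \esum_(d in [set: V j])
    (visit m [::] *
      (taboo (n - m) (append o [::] d) * (p d (o j))%:E))); last first.
  by apply: eq_bigr => m _; rewrite esumZl// => d; rewrite mule_ge0.
rewrite -esum_sum; last by move=> *; rewrite !mule_ge0.
apply: eq_esum => d _.
rewrite -[append _ _ _]cat0s visit_cat//= /Defs.coord /= untagE.
rewrite ge0_sume_distrl; last by move=> m _; rewrite mule_ge0.
by apply: eq_bigr => m _; rewrite muleA.
Qed.

Definition genfun (f : nat -> \bar R) (z : R) : \bar R :=
  \esum_(n in [set: nat]) (f n * (z ^+ n)%:E).

Lemma genfun_rcons x y z : (0 <= z)%R ->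
  genfun (visit ^~ (rcons x y)) z =
  genfun (visit ^~ x) z * genfun (taboo ^~ [:: y]) z.
Proof.
move=> z0; have zn0 n : 0 <= (z ^+ n)%:E by rewrite lee_fin exprn_ge0.
rewrite /genfun -esum_cauchy; last 2 first.
- by move=> n; rewrite mule_ge0.
- by move=> n; rewrite mule_ge0.
apply: eq_esum => n _; rewrite -cats1 visit_cat//.
rewrite ge0_sume_distrl; last by move=> m _; rewrite mule_ge0.
apply: eq_bigr => m _; rewrite muleACA -EFinM -exprD.
by rewrite subnKC// leq_ord.
Qed.

End WordsFreeProduct.

(** * Renewal equations *)

Section FiniteChoice.
Context {R : realType} {n : nat}.

Lemma fin_common_bound (P : 'I_n -> R -> Prop) :
  (forall i x y, 0 < y -> y <= x -> P i x -> P i y) ->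
  (forall i, exists2 x, 0 < x & P i x) ->
  exists2 x, 0 < x & forall i, P i x.
Proof.
move=> Pmono Pex.
have /choice[f fP] : forall i, exists x, 0 < x /\ P i x.
  by move=> i; have [x x0 Px] := Pex i; exists x.
have pos : 0 < \big[Num.min/1]_(i < n) f i.
  by elim/big_ind: _ => // [x y|i _]; rewrite ?lt_min; [move=> -> ->|case: (fP i)].
exists (\big[Num.min/1]_(i < n) f i) => // i.
apply: (Pmono _ (f i)) => //; first by rewrite bigmin_le_cond.
by case: (fP i).
Qed.

End FiniteChoice.

Section Renewal.
Context {R : realType} {r : nat}.
(** Here [u], [b] and [g] stand for the real values of [return_via], [level] and the return
    probabilities [visit n [::]]; the argument uses only their recursions. *)
Variables (alpha : 'I_r -> R) (u b : 'I_r -> nat -> R) (g : nat -> R).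
Hypothesis r2 : (2 <= r)%N.
Hypothesis alpha0 : forall k, 0 < alpha k.
Hypothesis alpha1 : \sum_(k < r) alpha k = 1.
Hypothesis u0 : forall k n, 0 <= u k n.
Hypothesis b0 : forall k n, 0 <= b k n.
Hypothesis g0 : forall n, 0 <= g n.
Hypothesis b_0 : forall k, b k 0 = 0.
Hypothesis b_1 : forall k, 0 < b k 1.
Hypothesis balance : forall k n,
  b k n.+1 + u k n = alpha k * ((n == 0)%:R + b k n) +
  \sum_(j < r | j != k) \sum_(m < n.+1) b k m * u j (n - m).
Hypothesis g_0 : g 0 = 1.
Hypothesis g_S : forall n,
  g n.+1 = \sum_(m < n.+1) g m * \sum_(j < r) u j (n - m).
Variables (rho0 Gam : R).
Hypothesis rho0_gt1 : 1 < rho0.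
Hypothesis g_rho0 : forall N, \sum_(n < N) g n * rho0 ^+ n <= Gam.

Lemma sum_conv (f h : nat -> R) N :
  \sum_(n < N) \sum_(m < n.+1) f m * h (n - m)%N =
  \sum_(m < N) f m * \sum_(l < N - m) h l.
Proof.
elim: N => [|N IH]; first by rewrite !big_ord0.
rewrite big_ord_recr/= IH [in RHS]big_ord_recr/= subSn// subnn big_ord1.
rewrite [X in _ + X]big_ord_recr/= subnn addrA; congr (_ + _).
rewrite -big_split/=; apply: eq_bigr => m _.
by rewrite subSn ?(ltnW (ltn_ord m))// big_ord_recr/= mulrDr.
Qed.

Lemma sum_ord_le (f : nat -> R) M N : (forall n, 0 <= f n) -> (M <= N)%N ->
  \sum_(n < M) f n <= \sum_(n < N) f n.
Proof.
move=> f0 MN; rewrite -(subnKC MN) big_split_ord/= lerDl.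
exact: sumr_ge0.
Qed.

(** Sum the balance equation over n and use [1 - alpha k = \sum_(j < r | j != k) alpha j]. Bounds on
    N terms of [u] yield a statement about [N.+1] terms, which lets [return_le_alpha] proceed by
    induction. *)
Lemma renewal_bound (Us : 'I_r -> R) N k :
  (forall j, \sum_(l < N) u j l <= Us j) ->
  \sum_(n < N.+1) u k n +
  (\sum_(n < N.+1) b k n) * \sum_(j < r | j != k) (alpha j - Us j) <= alpha k.
Proof.
move=> uUs; set S := \sum_(n < N.+1) b k n.
have : \sum_(n < N.+1) (b k n.+1 + u k n) <=
    alpha k + alpha k * S + S * \sum_(j < r | j != k) Us j.
  under eq_bigr do rewrite balance.
  rewrite big_split/= -mulr_sumr big_split/= mulrDr.
  rewrite {1}big_ord_recl/= big1 ?addr0 ?mulr1//.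
  rewrite lerD2l exchange_big/= mulr_sumr; apply: ler_sum => j _.
  rewrite (sum_conv (b k) (u j)) /S mulr_suml; apply: ler_sum => m _.
  (* [b k 0 = 0] removes the only inner sum of full length [N.+1]. *)
  case: m => -[|m] mN /=; first by rewrite b_0 !mul0r.
  rewrite ler_wpM2l//; apply: le_trans (uUs j).
  by apply: sum_ord_le => //; rewrite subSS leq_subr.
rewrite big_split/= => H.
have S' : \sum_(n < N.+1) b k n.+1 = S + b k N.+1.
  have <- : \sum_(n < N.+2) b k n = \sum_(n < N.+1) b k n.+1.
    by rewrite big_ord_recl b_0 add0r.
  by rewrite big_ord_recr.
have sa : \sum_(j < r | j != k) alpha j = 1 - alpha k.
  by rewrite -alpha1 [X in _ = X - _](bigD1 k)//= addrAC subrr add0r.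
rewrite sumrB sa; move: H; rewrite S'; have := b0 k N.+1.
by nra.
Qed.

Lemma return_le_alpha N k : \sum_(n < N) u k n <= alpha k.
Proof.
elim: N k => [|N IH] k; first by rewrite big_ord0 ltW.
have := renewal_bound k IH.
rewrite (_ : \sum_(j < r | j != k) (alpha j - alpha j) = 0) ?mulr0 ?addr0//.
by apply: big1 => j _; rewrite subrr.
Qed.

Definition return_prob k := limn (series (u k)).

Lemma return_series_cvg k : cvgn (series (u k)).
Proof.
apply: nondecreasing_is_cvgn; first exact: nondecreasing_series.
by exists (alpha k) => _ [N _ <-]; rewrite /series/= big_mkord return_le_alpha.
Qed.

Lemma return_prob_ge k N : \sum_(n < N) u k n <= return_prob k.
Proof.
rewrite -(big_mkord xpredT (u k)).
apply: (@nondecreasing_cvgn_le _ (series (u k))).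
  exact: nondecreasing_series.
exact: return_series_cvg.
Qed.

Lemma return_prob_le k x : (forall N, \sum_(n < N) u k n <= x) ->
  return_prob k <= x.
Proof.
move=> ux; apply: limr_le; first exact: return_series_cvg.
by apply: nearW => N; rewrite /series/= big_mkord.
Qed.

(** Probability of leaving o through factor k and never returning: a return via k requires a first
    step in factor k, which has probability [alpha k]. *)
Definition escape k := alpha k - return_prob k.

Lemma escape_ge0 k : 0 <= escape k.
Proof. by rewrite subr_ge0; apply: return_prob_le => N; exact: return_le_alpha. Qed.

(** Visiting a letter of type k before any return and then leaving it for ever through another
    factor are disjoint events for different letters and times, all contained in the escape through
    k. Formally it is the limit of [renewal_bound]. *)
Lemma level_escape k N :
  (\sum_(n < N) b k n) * \sum_(j < r | j != k) escape j <= escape k.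
Proof.
rewrite lerBrDr -lerBrDl; apply: return_prob_le => M.
rewrite lerBrDl.
have H := renewal_bound k (fun j => return_prob_ge j (maxn M N)).
apply: le_trans H; rewrite addrC; apply: lerD.
  by apply: sum_ord_le => //; rewrite leqW// leq_maxl.
apply: ler_wpM2r; first by apply: sumr_ge0 => j _; exact: escape_ge0.
by apply: sum_ord_le => //; rewrite leqW// leq_maxr.
Qed.

Lemma g_bounded N : \sum_(n < N) g n <= Gam.
Proof.
apply: le_trans (g_rho0 N); apply: ler_sum => n _.
by rewrite ler_peMr// exprn_ege1// ltW.
Qed.

(** Transience: with G the finite sum of [g] and U the total return probability, the renewal
    equation gives G = 1 + G U, so U <= (G - 1) / G < 1. *)
Lemma total_return : \sum_(k < r) return_prob k < 1.
Proof.
have gcvg : cvgn (series g).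
  apply: nondecreasing_is_cvgn; first exact: nondecreasing_series.
  by exists Gam => _ [N _ <-]; rewrite /series/= big_mkord g_bounded.
pose G := limn (series g).
have gG N : \sum_(n < N) g n <= G.
  rewrite -(big_mkord xpredT g).
  by apply: (@nondecreasing_cvgn_le _ (series g)) => //; exact: nondecreasing_series.
have G1 : 1 <= G by have := gG 1%N; rewrite big_ord1 g_0.
(* Truncated form of G U <= G - 1: products with m < M and l < N already occur among the first
   [(M + N).+1] values of [g]; then M tends to infinity. *)
have W N : G * \sum_(l < N) (\sum_(j < r) u j l) <= G - 1.
  have [->|Wn0] := eqVneq (\sum_(l < N) (\sum_(j < r) u j l)) 0.
    by rewrite mulr0 subr_ge0.
  have W0 : 0 < \sum_(l < N) (\sum_(j < r) u j l).
    by rewrite lt_def Wn0/=; do 2!(apply: sumr_ge0 => ? _).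
  rewrite -ler_pdivlMr//; apply: limr_le => //; apply: nearW => M.
  rewrite /series/= big_mkord ler_pdivlMr// lerBrDl.
  apply: le_trans (gG (M + N).+1); rewrite big_ord_recl g_0 lerD2l.
  under [leRHS]eq_bigr do rewrite lift0 g_S.
  rewrite (sum_conv g (fun l => \sum_(j < r) u j l)) mulr_suml.
  apply: le_trans (@sum_ord_le (fun m => g m * \sum_(l < M + N - m)
    \sum_(j < r) u j l) M (M + N)%N _ _); last 2 first.
  - by move=> m; rewrite mulr_ge0//; do 2!(apply: sumr_ge0 => ? _).
  - exact: leq_addr.
  apply: ler_sum => m _; apply: ler_wpM2l => //.
  apply: (@sum_ord_le (fun l => \sum_(j < r) u j l)).
    by move=> l; apply: sumr_ge0.
  by rewrite addnC -addnBA ?leq_addr// ltnW.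
have : \sum_(k < r) return_prob k <= (G - 1) / G.
  have cv : \sum_(k < r) series (u k) N @[N --> \oo] -->
      \sum_(k < r) return_prob k.
    by apply: cvg_big => [|k _]; [exact: add_continuous|exact: return_series_cvg].
  rewrite -(cvg_lim _ cv)//; apply: limr_le; first by apply/cvg_ex; eexists; exact: cv.
  apply: nearW => N; rewrite ler_pdivlMr ?(lt_le_trans ltr01)// mulrC.
  have -> : \sum_(k < r) series (u k) N = \sum_(l < N) \sum_(j < r) u j l.
    rewrite [RHS]exchange_big/=; apply: eq_bigr => k _.
    by rewrite /series/= big_mkord.
  exact: W.
move=> /le_lt_trans; apply; rewrite ltr_pdivrMr ?(lt_le_trans ltr01)//.
by lra.
Qed.

(** By [total_return] some factor allows escape. It passes this on to every other factor j through
    [level_escape], since [b j 1 > 0]: step to a letter of type j, then escape from there. *)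
Lemma escape_gt0 k : 0 < escape k.
Proof.
have [j0 dj0] : exists j, 0 < escape j.
  apply: contrapT => /forallNP h; have := total_return.
  rewrite -alpha1 ltNge => /negP; apply; apply: ler_sum => j _.
  by have /negP := h j; rewrite -leNgt subr_le0.
have step i j : i != j -> 0 < escape i -> 0 < escape j.
  move=> ij di; apply: lt_le_trans (level_escape j 2).
  rewrite big_ord_recl big_ord1/= b_0 add0r mulr_gt0//.
  rewrite (bigD1 i)//= ltr_pwDl// sumr_ge0// => *; exact: escape_ge0.
have [->//|kj] := eqVneq k j0; apply: (step j0) => //.
by rewrite eq_sym.
Qed.

Lemma escape_others_gt0 k : 0 < \sum_(j < r | j != k) escape j.
Proof.
have [j jk] : exists j, j != k.
  have z : (0 < r)%N by apply: leq_trans r2.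
  have [k0|k0] := eqVneq (k : nat) 0%N.
    by exists (Ordinal r2); rewrite -val_eqE/= k0.
  by exists (Ordinal z); rewrite -val_eqE/= eq_sym.
rewrite (bigD1 j)//= ltr_pwDl ?escape_gt0// sumr_ge0// => *.
exact: escape_ge0.
Qed.

Lemma return_le_g j n : u j n <= g n.+1.
Proof.
rewrite g_S big_ord_recl/= g_0 mul1r subn0 (bigD1 j)//=.
rewrite -addrA lerDl addr_ge0// sumr_ge0// => m _; rewrite mulr_ge0//.
exact: sumr_ge0.
Qed.

(** Convexity of the n-th power. It compares a power series at a point slightly above 1 with its
    values at 1 and [rho0], and thus replaces a continuity argument. *)
Lemma expr_convex (t : R) n : 0 <= t <= 1 ->
  (1 + t * (rho0 - 1)) ^+ n <= 1 - t + t * rho0 ^+ n.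
Proof.
move=> /andP[t0 t1]; elim: n => [|n IH]; first by rewrite !expr0; lra.
rewrite exprS; have : 1 <= rho0 ^+ n by rewrite exprn_ege1// ltW.
rewrite exprS; move: (rho0 ^+ n) (_ ^+ n) IH => A B IH A1.
have H : (1 + t * (rho0 - 1)) * B <= (1 + t * (rho0 - 1)) * (1 - t + t * A).
  by rewrite ler_wpM2l// addr_ge0// mulr_ge0// subr_ge0 ltW.
apply: le_trans H _; have /ltW := rho0_gt1; rewrite -subr_ge0 => q0.
rewrite -subr_ge0 [X in 0 <= X](_ : _ = t * (1 - t) * ((A - 1) * (rho0 - 1))).
  by rewrite !mulr_ge0// subr_ge0.
by ring.
Qed.

(** For fixed k the balance equation is a renewal equation for [b k] whose kernel has mass
    [1 - \sum_(j < r | j != k) escape j < 1]. The mass stays below 1 for a [rho] slightly above 1,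
    which bounds the weighted sums. *)
Lemma level_exp_moment : exists rho M : R,
  [/\ 1 < rho, rho <= rho0 &
      forall k N, \sum_(n < N) b k n * rho ^+ n <= M].
Proof.
pose E k := \sum_(j < r | j != k) escape j.
(* [C] bounds the growth of the kernel mass per unit of [t]: [rho0] for the part [alpha k * rho],
   and [Gam] for each return series. *)
pose C := rho0 + r%:R * Gam.
have Gam0 : 0 <= Gam by have := g_rho0 0; rewrite big_ord0.
have C0 : 0 < C.
  by rewrite ltr_pwDl ?(lt_trans ltr01)// mulr_ge0.
have [e e0 eE] := @fin_common_bound R r (fun k e => e <= E k)
  (fun i x y _ yx => le_trans yx)
  (fun k => ex_intro2 _ _ (E k) (escape_others_gt0 k) (lexx _)).
pose t := Num.min 1 (e / (2 * C)).
have t0 : 0 < t by rewrite lt_min ltr01 divr_gt0// mulr_gt0.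
have t1 : t <= 1 by rewrite ge_min lexx.
have tC : t * C <= e / 2.
  have : t <= e / (2 * C) by rewrite ge_min lexx orbT.
  by rewrite ler_pdivlMr ?mulr_gt0//; lra.
pose rho := 1 + t * (rho0 - 1).
have rho1 : 1 < rho by rewrite ltrDl mulr_gt0// subr_gt0.
have rho_le : rho <= rho0 by rewrite /rho; have := rho0_gt1; nra.
exists rho, (2 * rho0 / e); split=> // k N.
have a1 : alpha k <= 1.
  by rewrite -alpha1 (bigD1 k)//= lerDl sumr_ge0// => j _; exact: ltW.
(* At 1 the kernel mass is at most [1 - E k <= 1 - e]; moving to [rho] adds at most
   [t * C <= e / 2]. *)
have K N' : alpha k * rho + \sum_(j < r | j != k) \sum_(l < N') u j l * rho ^+ l.+1
    <= 1 - e / 2.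
  have Hj j : \sum_(l < N') u j l * rho ^+ l.+1 <= return_prob j + t * Gam.
    apply: (@le_trans _ _ (\sum_(l < N') (u j l + t * (g l.+1 * rho0 ^+ l.+1)))).
      apply: ler_sum => l _; apply: (@le_trans _ _
        (u j l * (1 - t + t * rho0 ^+ l.+1))).
        by rewrite ler_wpM2l// expr_convex// t1 ltW.
      rewrite mulrDr lerD//; first by rewrite ler_piMr// lerBlDr lerDl ltW.
      rewrite mulrCA; apply: ler_wpM2l; first exact: ltW.
      apply: ler_wpM2r; last exact: return_le_g.
      by rewrite exprn_ge0// ltW// (lt_trans ltr01).
    rewrite big_split/= lerD ?return_prob_ge// -mulr_sumr.
    apply: ler_wpM2l; first exact: ltW.
    apply: le_trans (g_rho0 N'.+1); rewrite big_ord_recl/= lerDr.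
    by rewrite mulr_ge0// exprn_ge0// ltW// (lt_trans ltr01).
  have HS : \sum_(j < r | j != k) \sum_(l < N') u j l * rho ^+ l.+1 <=
      1 - alpha k - E k + t * (r%:R * Gam).
    apply: le_trans (ler_sum _ (fun j _ => Hj j)) _.
    rewrite big_split/= lerD//.
      have sa : \sum_(j < r | j != k) alpha j = 1 - alpha k.
        by rewrite -alpha1 [X in _ = X - _](bigD1 k)//= addrAC subrr add0r.
      by rewrite /E /escape sumrB sa; lra.
    rewrite -mulr_sumr; apply: ler_wpM2l; first exact: ltW.
    rewrite sumr_const mulr_natl.
    rewrite -[X in _ <= _ *+ X]card_ord.
    by apply: ler_wpMn2l => //; apply: max_card.
  have ak := alpha0 k.
  have : alpha k * rho <= alpha k + t * rho0.
    rewrite /rho mulrDr mulr1 lerD2l mulrCA; apply: ler_wpM2l; first exact: ltW.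
    have /ltW := rho0_gt1; nra.
  have := eE k; have := tC; rewrite /C mulrDr; lra.
have T0 M : 0 <= \sum_(n < M) b k n * rho ^+ n.
  by apply: sumr_ge0 => n _; rewrite mulr_ge0// exprn_ge0// ltW// (lt_trans ltr01).
(* The weight [rho ^+ n.+1] splits along the convolution. As the partial sums increase, T <= rho0 +
   (1 - e/2) T follows, hence the constant [2 * rho0 / e]. *)
have TS M : \sum_(n < M.+1) b k n * rho ^+ n <=
    rho0 + (1 - e / 2) * \sum_(n < M) b k n * rho ^+ n.
  rewrite big_ord_recl b_0 mul0r add0r/=.
  apply: (@le_trans _ _ (\sum_(n < M) (alpha k * ((n == 0 :> nat)%:R + b k n) +
     \sum_(j < r | j != k) \sum_(m < n.+1) b k m * u j (n - m)) * rho ^+ n.+1)).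
    apply: ler_sum => n _; rewrite ler_wpM2r ?exprn_ge0//.
      by rewrite ltW// (lt_trans ltr01).
    by rewrite -balance lerDl.
  under [leLHS]eq_bigr do rewrite mulrDl.
  rewrite [leLHS]big_split/=.
  have -> : \sum_(n < M) (\sum_(j < r | j != k) \sum_(m < n.+1)
        b k m * u j (n - m)) * rho ^+ n.+1 =
      \sum_(j < r | j != k) \sum_(m < M) b k m * rho ^+ m *
         \sum_(l < M - m) u j l * rho ^+ l.+1.
    under eq_bigr do rewrite mulr_suml.
    rewrite exchange_big/=; apply: eq_bigr => j _.
    rewrite -(sum_conv (fun m => b k m * rho ^+ m) (fun l => u j l * rho ^+ l.+1)).
    apply: eq_bigr => n _; rewrite mulr_suml; apply: eq_bigr => m _.
    rewrite mulrACA -exprD addnS subnKC// -ltnS; exact: ltn_ord.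
  have A1 : \sum_(n < M) alpha k * ((n == 0 :> nat)%:R + b k n) * rho ^+ n.+1 <=
      rho0 + alpha k * rho * \sum_(n < M) b k n * rho ^+ n.
    rewrite mulr_sumr.
    have -> : \sum_(n < M) alpha k * ((n == 0 :> nat)%:R + b k n) * rho ^+ n.+1 =
       \sum_(n < M) alpha k * (n == 0 :> nat)%:R * rho ^+ n.+1 +
       \sum_(n < M) alpha k * rho * (b k n * rho ^+ n).
      by rewrite -big_split/=; apply: eq_bigr => n _; rewrite exprS; ring.
    rewrite lerD2r; case: (M) => [|M']; first by rewrite big_ord0 ltW// (lt_trans ltr01).
    rewrite big_ord_recl/= big1 ?addr0 ?mulr1; last by move=> n _; rewrite mulr0 mul0r.
    apply: le_trans rho_le; rewrite expr1 ler_piMl//.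
    by rewrite ltW// (lt_trans ltr01).
  apply: le_trans (lerD A1 (lexx _)) _; rewrite -addrA lerD2l.
  apply: (@le_trans _ _ ((alpha k * rho + \sum_(j < r | j != k)
     \sum_(l < M) u j l * rho ^+ l.+1) * \sum_(n < M) b k n * rho ^+ n)); last first.
    by rewrite ler_wpM2r.
  rewrite mulrDl lerD2l mulr_suml; apply: ler_sum => j _.
  rewrite mulrC mulr_suml; apply: ler_sum => m _; rewrite ler_wpM2l//.
    by rewrite mulr_ge0// exprn_ge0// ltW// (lt_trans ltr01).
  apply: (@sum_ord_le (fun l => u j l * rho ^+ l.+1)); last exact: leq_subr.
  by move=> l; rewrite mulr_ge0// exprn_ge0// ltW// (lt_trans ltr01).
have := TS N; have : \sum_(n < N) b k n * rho ^+ n <= \sum_(n < N.+1) b k n * rho ^+ n.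
  apply: (@sum_ord_le (fun n => b k n * rho ^+ n)) => //.
  by move=> l; rewrite mulr_ge0// exprn_ge0// ltW// (lt_trans ltr01).
move=> /le_trans h /h; rewrite ler_pdivlMr//.
by lra.
Qed.

End Renewal.

(** * Exponential tilting *)

Section HasSum.
Context {R : realType} {T : choiceType}.
Implicit Types (f g : T -> R) (s t : R).

(** Summability and value in one relation, so that sums can be compared by linear arithmetic in
    R. *)
Definition has_sum f s :=
  (forall x, 0 <= f x) /\ (\esum_(x in [set: T]) (f x)%:E = s%:E)%E.

Lemma has_sum_ge0 f s : has_sum f s -> 0 <= s.
Proof. by case=> f0 fs; rewrite -lee_fin -fs esum_ge0// => x _; rewrite lee_fin. Qed.

Lemma has_sumD f g s t :
  has_sum f s -> has_sum g t -> has_sum (fun x => f x + g x) (s + t).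
Proof.
move=> [f0 fs] [g0 gt]; split; first by move=> x; rewrite addr_ge0.
rewrite EFinD -fs -gt -esumD; last 2 first.
- by move=> x _; rewrite lee_fin.
- by move=> x _; rewrite lee_fin.
by apply: eq_esum => x _; rewrite EFinD.
Qed.

Lemma has_sumZ f s c : 0 <= c -> has_sum f s -> has_sum (fun x => c * f x) (c * s).
Proof.
move=> c0 [f0 fs]; split; first by move=> x; rewrite mulr_ge0.
by rewrite EFinM -fs -esumZl// => x; rewrite lee_fin.
Qed.

Lemma has_sum_le f g s t :
  (forall x, f x <= g x) -> has_sum f s -> has_sum g t -> s <= t.
Proof.
move=> fg [_ fs] [_ gt]; rewrite -lee_fin -fs -gt.
by apply: le_esum => x _; rewrite lee_fin.
Qed.

Lemma has_sum_bounded f s : (forall x, 0 <= f x) ->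
  (\esum_(x in [set: T]) (f x)%:E <= s%:E)%E -> exists2 t, has_sum f t & t <= s.
Proof.
move=> f0 fs.
have fin : (\esum_(x in [set: T]) (f x)%:E)%E \is a fin_num.
  rewrite ge0_fin_numE ?(le_lt_trans fs)// ?ltry//.
  by apply: esum_ge0 => x _; rewrite lee_fin.
exists (fine (\esum_(x in [set: T]) (f x)%:E)%E); last by rewrite -lee_fin fineK.
by split=> //; rewrite fineK.
Qed.

Lemma has_sum_dom f g t : (forall x, 0 <= f x <= g x) ->
  has_sum g t -> exists2 s, has_sum f s & s <= t.
Proof.
move=> fg [g0 gt]; apply: has_sum_bounded; first by move=> x; case/andP: (fg x).
by rewrite -gt; apply: le_esum => x _; rewrite lee_fin; case/andP: (fg x).
Qed.

End HasSum.

Section Tilt.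
Context {R : realType}.

(** For [u >= 0] the inequality [expR u <= 1 + u * expR u] is inserted into itself; for [u < 0] the
    bound [expR u * (1 - u) <= 1] already suffices. *)
Lemma expR_le2 (u : R) : expR u <= 1 + u + u ^+ 2 * expR `|u|.
Proof.
have h : expR u * (1 - u) <= 1.
  rewrite -[leRHS](expRxMexpNx_1 u) ler_wpM2l ?expR_ge0//.
  exact: expR_ge1Dx.
have [u0|u0] := leP 0 u; first by rewrite ger0_norm//; nra.
have h2 := expR_ge1Dx u.
have : u ^+ 2 <= u ^+ 2 * expR `|u|.
  by rewrite ler_peMr ?sqr_ge0// -expR0 ler_expR.
by nra.
Qed.

Lemma sqr_le_expR (x : R) : 0 <= x -> x ^+ 2 <= 4 * expR x.
Proof.
move=> x0; have h := expR_ge1Dx (x / 2).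
have -> : expR x = expR (x / 2) ^+ 2 by rewrite -expRM_natl; congr expR; lra.
by nra.
Qed.

Variables (T : choiceType) (q c : T -> R) (len : T -> nat) (C0 delta M : R).
Hypothesis C00 : 0 <= C0.
Hypothesis delta0 : 0 < delta.
Hypothesis c_len : forall x, 0 < q x -> `|c x| <= C0 * ((len x)%:R + 1).
Hypothesis q_exp : has_sum (fun x => q x * expR (delta * (len x)%:R)) M.

Lemma tilt_q_ge0 x : 0 <= q x.
Proof. by have := q_exp.1 x; rewrite pmulr_lge0// expR_gt0. Qed.

(** Second-order upper bounds for both signs of t. [Lam] is minus the sum of [q x * c x], so the
    linear coefficient is the mean of the exponent; [A], [N] and [Lam] do not depend on [eta]. *)
Lemma tilt_expansion : exists A N Lam : R,
  [/\ has_sum q A, has_sum (fun x => q x * (len x)%:R) N &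
  forall eta, 0 <= eta -> exists C t0 : R, 0 < t0 /\ forall t, 0 < t <= t0 ->
    (exists2 s, has_sum (fun x => q x * expR (t * (eta * (len x)%:R + c x))) s
                & s <= A + t * (eta * N - Lam) + t ^+ 2 * C) /\
    (exists2 s, has_sum (fun x => q x * expR (- t * (eta * (len x)%:R + c x))) s
                & s <= A - t * (eta * N - Lam) + t ^+ 2 * C)].
Proof.
have q0 := tilt_q_ge0.
have len0 x : 0 <= (len x)%:R :> R by [].
have [A qA _] : exists2 A, has_sum q A & A <= M.
  apply: has_sum_dom q_exp => x.
  by rewrite q0 ler_peMr// -expR0 ler_expR mulr_ge0// ltW.
have [N qN _] : exists2 N, has_sum (fun x => q x * (len x)%:R) N
    & N <= delta^-1 * M.
  apply: has_sum_dom (has_sumZ _ q_exp) => [x|]; last by rewrite invr_ge0 ltW.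
  rewrite mulr_ge0//= mulrCA ler_wpM2l// ler_pdivlMl//.
  by apply: le_trans (expR_ge1Dx _); rewrite lerDr.
have cb x : q x * `|c x| <= q x * (C0 * ((len x)%:R + 1)).
  have [qx|] := ltP 0 (q x); first by rewrite ler_pM2l// c_len.
  by rewrite le_eqVlt ltNge q0 orbF => /eqP ->; rewrite !mul0r.
have cb1 x : q x * c x <= q x * (C0 * ((len x)%:R + 1)).
  by apply: le_trans (cb x); rewrite ler_wpM2l// ler_norm.
have cb2 x : - (q x * c x) <= q x * (C0 * ((len x)%:R + 1)).
  by apply: le_trans (cb x); rewrite -mulrN ler_wpM2l// -normrN ler_norm.
(* [c] has no sign; adding its bound makes the family nonnegative, so that its sum makes sense in
   [has_sum]. *)
have [H qH _] : exists2 H,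
    has_sum (fun x => q x * (C0 * ((len x)%:R + 1) - c x)) H
    & H <= (2 * C0) * (N + A).
  apply: has_sum_dom (has_sumZ _ (has_sumD qN qA)) => [x|]; last first.
    by rewrite mulr_ge0.
  by have := cb1 x; have := cb2 x => h1 h2; apply/andP; split => /=; lra.
exists A, N, (H - C0 * (N + A)); split=> // eta eta0.
pose D := C0 + eta + 1; have D0 : 0 < D by rewrite ltr_wpDl// addr_ge0.
(* With [|v| <= D * (l + 1)], half of the exponential moment absorbs the square [(l + 1) ^+ 2]
   through [sqr_le_expR], whence 16, and the other half absorbs [expR (t * |v|)] for
   [t <= delta / (2 * D)]. The factor [expR delta] pays for [l + 1] in place of [l]. *)
pose C1 := D ^+ 2 * (16 * delta ^- 2 * expR delta).
have d20 : 0 <= delta ^- 2 by rewrite invr_ge0 exprn_ge0// ltW.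
have C10 : 0 <= C1.
  by rewrite mulr_ge0 ?sqr_ge0// mulr_ge0 ?expR_ge0// mulr_ge0.
exists (C1 * M), (delta / (2 * D)); split; first by rewrite divr_gt0// mulr_gt0.
have key (sg t : R) x : `|sg| = 1 -> 0 < t <= delta / (2 * D) ->
    q x * expR (sg * t * (eta * (len x)%:R + c x)) <=
    q x * (1 + sg * t * (eta * (len x)%:R + c x)) +
    t ^+ 2 * (C1 * (q x * expR (delta * (len x)%:R))).
  move=> sg1 /andP[t0 tD]; have [qx|] := ltP 0 (q x); last first.
    by rewrite le_eqVlt ltNge q0 orbF => /eqP ->; rewrite !mul0r !mulr0 addr0.
  rewrite [X in _ <= _ + X](_ : _ = q x * (t ^+ 2 *
      (C1 * expR (delta * (len x)%:R)))); last by ring.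
  rewrite -mulrDr ler_pM2l//; apply: le_trans (expR_le2 _) _; rewrite lerD2l.
  set l := (len x)%:R : R; set v := eta * l + c x.
  have l0 : 0 <= l by [].
  have vD : `|v| <= D * (l + 1).
    rewrite (le_trans (ler_normD _ _))// ger0_norm ?mulr_ge0//.
    by have := c_len qx; rewrite -/l /D; nra.
  have -> : (sg * t * v) ^+ 2 = t ^+ 2 * `|v| ^+ 2.
    rewrite -(real_normK (num_real (sg * t * v))) !normrM sg1 mul1r exprMn.
    by rewrite (ger0_norm (ltW t0)).
  rewrite -mulrA ler_pM2l ?exprn_gt0//.
  have h1 : `|v| ^+ 2 <= D ^+ 2 * (l + 1) ^+ 2.
    by rewrite -exprMn lerXn2r// nnegrE// ltW// mulr_gt0//; lra.
  have h2 : `|sg * t * v| <= delta / 2 * (l + 1).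
    rewrite !normrM sg1 mul1r (ger0_norm (ltW t0)).
    apply: le_trans (ler_wpM2l (ltW t0) vD) _.
    rewrite mulrA ler_wpM2r//; first lra.
    by move: tD; rewrite ler_pdivlMr ?mulr_gt0//; lra.
  have h3 : (l + 1) ^+ 2 <= 16 * delta ^- 2 * expR (delta / 2 * (l + 1)).
    have := @sqr_le_expR (delta / 2 * (l + 1)).
    rewrite mulr_ge0 ?divr_ge0 ?(ltW delta0) ?addr_ge0// => /(_ isT).
    move: (expR _) => E h.
    rewrite mulrAC ler_pdivlMr ?exprn_gt0//.
    by move: h; lra.
  apply: le_trans (ler_wpM2r (expR_ge0 _) h1) _.
  apply: le_trans (ler_wpM2l _ (_ : _ <= expR (delta / 2 * (l + 1)))) _.
  - by rewrite mulr_ge0 ?sqr_ge0.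
  - by rewrite ler_expR.
  apply: le_trans (ler_wpM2r (expR_ge0 _) (ler_wpM2l (sqr_ge0 D) h3)) _.
  rewrite /C1 -!mulrA.
  do 2!(apply: ler_wpM2l; first exact: ltW).
  do 2!(apply: ler_wpM2l => //).
  by rewrite -!expRD ler_expR; lra.
move=> t tt; have /andP[t0 _] := tt; split.
  have qR := has_sumD (has_sumD (has_sumD qA (has_sumZ (mulr_ge0 (ltW t0) eta0) qN))
    (has_sumZ (mulr_ge0 (ltW t0) C00) (has_sumD qN qA)))
    (has_sumZ (sqr_ge0 t) (has_sumZ C10 q_exp)).
  have kx x := key 1 t x (normr1 _) tt.
  have [s qs _] : exists2 s, has_sum
      (fun x => q x * expR (t * (eta * (len x)%:R + c x))) s &
      s <= A + t * eta * N + t * C0 * (N + A) + t ^+ 2 * (C1 * M).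
    apply: has_sum_dom qR => x; rewrite mulr_ge0 ?expR_ge0//=.
    have := kx x; rewrite mul1r => h; apply: le_trans h _.
    by have := ler_wpM2l (ltW t0) (cb1 x); lra.
  exists s => //.
  suff : s + t * H <= A + t * eta * N + t * C0 * (N + A) + t ^+ 2 * (C1 * M).
    by lra.
  apply: has_sum_le (has_sumD qs (has_sumZ (ltW t0) qH)) qR => x.
  by have := kx x; rewrite mul1r; lra.
have qR := has_sumD (has_sumD qA (has_sumZ (ltW t0) qH))
    (has_sumZ (sqr_ge0 t) (has_sumZ C10 q_exp)).
have kx x := key (-1) t x (normrN1 _) tt.
have [s qs _] : exists2 s, has_sum
    (fun x => q x * expR (- t * (eta * (len x)%:R + c x))) s &
    s <= A + t * H + t ^+ 2 * (C1 * M).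
  apply: has_sum_dom qR => x; rewrite mulr_ge0 ?expR_ge0//=.
  have := kx x; rewrite mulN1r => h; apply: le_trans h _.
  have := mulr_ge0 (ltW t0) (mulr_ge0 (mulr_ge0 (q0 x) eta0) (len0 x)).
  have := mulr_ge0 (ltW t0) (mulr_ge0 (q0 x) (mulr_ge0 C00 (addr_ge0 (len0 x) ler01))).
  by lra.
exists s => //.
suff : s + t * eta * N + t * C0 * (N + A) <= A + t * H + t ^+ 2 * (C1 * M).
  by lra.
apply: has_sum_le (has_sumD (has_sumD qs (has_sumZ (mulr_ge0 (ltW t0) eta0) qN))
  (has_sumZ (mulr_ge0 (ltW t0) C00) (has_sumD qN qA))) qR => x.
by have := kx x; rewrite mulN1r; lra.
Qed.

End Tilt.

(** * Reduced words and the critical slope *)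

Section WordSums.
Context {R : realType} {r : nat} {V : 'I_r -> countType}.
Variables (o : forall i, V i) (w : letter V -> R) (a : 'I_r -> R).
Hypothesis w0 : forall y, 0 <= w y.
Hypothesis wa : forall i,
  has_sum (fun c : V i => if c == o i then 0 else w (Tagged V c)) (a i).
Hypothesis a_sub : \sum_(i < r) a i / (1 + a i) < 1.

Let a0 i : 0 <= a i. Proof. exact: has_sum_ge0 (wa i). Qed.

(** Words longer than N, or not allowed after a letter of type [prev], get weight 0. The truncation
    permits induction on N. *)
Fixpoint word_weight (N : nat) (prev : option 'I_r) (s : seq (letter V)) : R :=
  match s, N with
  | [::], _ => 1
  | y :: s', 0%N => 0
  | y :: s', N'.+1 =>
    if (tagged y != o (tag y)) && (prev != Some (tag y))
    then w y * word_weight N' (Some (tag y)) s' else 0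
  end.

Lemma word_weight_ge0 N prev s : 0 <= word_weight N prev s.
Proof.
elim: s N prev => [|y s IH] [|N] prev //=.
by case: ifP => // _; rewrite mulr_ge0.
Qed.

Lemma word_weightE N prev s : reduced o s -> (size s <= N)%N ->
  (if s is y :: _ then prev != Some (tag y) else true) ->
  word_weight N prev s = \prod_(y <- s) w y.
Proof.
elim: s N prev => [|y s IH] [|N] prev //=; rewrite ?big_nil// big_cons.
rewrite ltnS /reduced /= => /andP[/andP[-> As] Ps] sN -> /=.
congr (_ * _); apply: IH => //.
  by rewrite /reduced As; case: (s) Ps => //= z s' /andP[].
by case: (s) Ps => //= z s' /andP[].
Qed.

Let B := (1 - \sum_(i < r) a i / (1 + a i))^-1.

Let Bp (prev : option 'I_r) := if prev is Some i then B / (1 + a i) else B.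

Let a1 i : 0 < 1 + a i. Proof. by rewrite ltr_pwDl. Qed.

Let B_gt0 : 0 < B. Proof. by rewrite invr_gt0 subr_gt0. Qed.

(* Bp solves the linear system of the generating functions of reduced words
   with prescribed type of the preceding letter. *)
Lemma Bp_eq prev :
  1 + \sum_(i < r | prev != Some i) a i * Bp (Some i) = Bp prev.
Proof.
have tot : 1 + \sum_(i < r) a i * Bp (Some i) = B.
  have -> : \sum_(i < r) a i * Bp (Some i) = B * \sum_(i < r) a i / (1 + a i).
    by rewrite mulr_sumr; apply: eq_bigr => i _; rewrite /Bp mulrCA mulrA.
  have BB : B * (1 - \sum_(i < r) a i / (1 + a i)) = 1.
    by rewrite mulVf// gt_eqF// subr_gt0.
  by move: BB; rewrite mulrBr mulr1 => /eqP; rewrite subr_eq => /eqP <-.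
case: prev => [k|] /=; last by rewrite -[RHS]tot.
have : 1 + \sum_(i < r | Some k != Some i) a i * Bp (Some i) =
    B - a k * Bp (Some k).
  rewrite -tot [in RHS](bigD1 k)//= addrCA addrAC subrr add0r.
  by congr (_ + _); apply: eq_bigl => i; rewrite eq_sym.
move=> ->; rewrite /Bp; field.
by rewrite gt_eqF.
Qed.

(** Splitting off the first letter, truncated sums below the positive fixed point [Bp] stay below
    it. *)
Lemma word_weight_sum N prev :
  (\esum_(s in [set: seq (letter V)]) (word_weight N prev s)%:E <= (Bp prev)%:E)%E.
Proof.
have Bp0 q : 0 < Bp q by case: q => [i|] //=; rewrite divr_gt0.
have Bp1 q : 1 <= Bp q.
  rewrite -Bp_eq lerDl sumr_ge0// => i _.
  by rewrite mulr_ge0// ltW.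
elim: N prev => [|N IH] prev.
  rewrite (esum_delta (x := [::]))//= ?lee_fin//; last by case.
  by move=> s; rewrite lee_fin (word_weight_ge0 0).
rewrite esum_seq_cons; last by move=> s; rewrite lee_fin word_weight_ge0.
pose f (y : letter V) : R :=
  if (tagged y != o (tag y)) && (prev != Some (tag y))
  then w y * Bp (Some (tag y)) else 0.
have f0 y : 0 <= f y by rewrite /f; case: ifP => // _; rewrite mulr_ge0// ltW.
apply: (@le_trans _ _ (1 + \esum_(y in [set: letter V]) (f y)%:E)%E).
  rewrite leeD2l//; apply: le_esum => y _ /=; rewrite /f.
  case: ifP => _; last by rewrite esum1.
  under eq_esum do rewrite EFinM.
  rewrite esumZl ?lee_fin//; last by move=> s; rewrite lee_fin word_weight_ge0.
  by rewrite EFinM lee_wpmul2l// lee_fin.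
rewrite esum_tagged; last by move=> y; rewrite lee_fin.
rewrite -Bp_eq EFinD leeD2l// (bigID (fun i => prev != Some i))/=.
rewrite [X in (_ + X)%E]big1 ?adde0; last first.
  by move=> i /negPf ip; rewrite esum1// => c _; rewrite /f/= ip andbF.
rewrite -sumEFin; apply: lee_sum => i ip.
rewrite EFinM muleC -(wa i).2 -esumZl; last 2 first.
- by rewrite lee_fin; exact: ltW (Bp0 (Some i)).
- by move=> c; rewrite lee_fin; case: ifP.
apply: le_esum => c _; rewrite -EFinM lee_fin /f/= ip andbT.
by case: eqVneq => _ /=; rewrite ?mulr0// mulrC.
Qed.

Lemma reduced_words_sum :
  (\esum_(x in [set: free_product o]) (\prod_(y <- val x) w y)%:E < +oo)%E.
Proof.
apply: (@le_lt_trans _ _ B%:E); last exact: ltry.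
apply: ge_ereal_sup => _ [F [finF _] <-].
(* A finite subsum involves words of bounded length only, so truncation at N loses nothing. *)
pose N := \max_(x <- finmap.enum_fset (fset_set F)) size (val x).
apply: le_trans (word_weight_sum N None).
apply: (@le_trans _ _
  (\esum_(x in [set: free_product o]) (word_weight N None (val x))%:E)%E); last first.
  apply: (@esum_inj_le _ _ _ val (fun s => (word_weight N None s)%:E)).
    exact: val_inj.
  by move=> s; rewrite lee_fin word_weight_ge0.
apply: esum_ge; exists F => //; rewrite !fsbig_finite//=.
rewrite [leLHS]big_seq_cond [leRHS]big_seq_cond; apply: lee_sum => x.
rewrite andbT => xF; rewrite lee_fin word_weightE//; first exact: valP.
  by rewrite /N; apply: (@leq_bigmax_seq _ _ xpredT (fun x => size (val x))).
by case: (val x).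
Qed.

End WordSums.

(** * The slope at which the tilted letter sums become subcritical *)

Section Threshold.
Context {R : realType} {r : nat}.

(** Tangent line at [a] of the concave function s / (1 + s). *)
Lemma frac_concave (s a : R) : 0 <= s -> 0 <= a ->
  s / (1 + s) <= a / (1 + a) + (s - a) / (1 + a) ^+ 2.
Proof.
move=> s0 a0.
have s1 : 0 < 1 + s by rewrite ltr_pwDl.
have a1 : 0 < 1 + a by rewrite ltr_pwDl.
rewrite -subr_ge0.
rewrite [X in 0 <= X](_ : _ = (s - a) ^+ 2 / ((1 + s) * (1 + a) ^+ 2)).
  by rewrite divr_ge0 ?sqr_ge0// ltW// mulr_gt0// exprn_gt0.
by field; rewrite !gt_eqF.
Qed.

Lemma subcritical_perturb (A m C : 'I_r -> R) (t0 : R) :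
  (forall k, 0 <= A k) -> \sum_(k < r) A k / (1 + A k) <= 1 ->
  \sum_(k < r) m k / (1 + A k) ^+ 2 < 0 -> 0 < t0 ->
  exists2 t, 0 < t <= t0 & forall s : 'I_r -> R,
    (forall k, 0 <= s k <= A k + t * m k + t ^+ 2 * C k) ->
    \sum_(k < r) s k / (1 + s k) < 1.
Proof.
move=> A0 Acrit mneg t00.
pose gap := - \sum_(k < r) m k / (1 + A k) ^+ 2.
have gap0 : 0 < gap by rewrite oppr_gt0.
pose Cs := \sum_(k < r) C k / (1 + A k) ^+ 2.
(* So small that the quadratic term uses up at most half of the linear gain. *)
pose t := Num.min t0 (gap / (2 * (`|Cs| + 1))).
have Cs1 : 0 < `|Cs| + 1 by rewrite ltr_wpDl.
have tp : 0 < t by rewrite lt_min t00 divr_gt0// mulr_gt0.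
exists t; first by rewrite tp ge_min lexx.
move=> s sb.
apply: (@le_lt_trans _ _ (\sum_(k < r) (A k / (1 + A k) +
   (t * (m k / (1 + A k) ^+ 2) + t ^+ 2 * (C k / (1 + A k) ^+ 2))))).
  apply: ler_sum => k _; have /andP[s0 sk] := sb k.
  apply: le_trans (frac_concave s0 (A0 k)) _; rewrite lerD2l.
  rewrite !mulrA -mulrDl ler_wpM2r ?invr_ge0 ?sqr_ge0//.
  by rewrite lerBlDl addrA.
rewrite big_split/= big_split/= -!mulr_sumr -/Cs.
have -> : \sum_(i < r) m i / (1 + A i) ^+ 2 = - gap by rewrite opprK.
have h : t * (`|Cs| + 1) <= gap / 2.
  have : t <= gap / (2 * (`|Cs| + 1)) by rewrite ge_min lexx orbT.
  by rewrite ler_pdivlMr ?mulr_gt0//; lra.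
have CsC := ler_norm Cs.
have h2 : t * Cs <= gap / 2 by nra.
have h3 : t * (t * Cs) <= t * (gap / 2) by rewrite ler_pM2l.
by have tg : 0 < t * gap by [rewrite mulr_gt0]; lra.
Qed.

Variables (T : 'I_r -> choiceType) (q c : forall k, T k -> R).
Variables (len : forall k, T k -> nat) (C0 delta : R).
Hypothesis C00 : 0 <= C0.
Hypothesis delta0 : 0 < delta.
Hypothesis r0 : (0 < r)%N.
Hypothesis c_len : forall k (x : T k), 0 < q x ->
  `|c x| <= C0 * ((len x)%:R + 1).
Hypothesis q_exp : forall k, exists M,
  has_sum (fun x : T k => q x * expR (delta * (len x)%:R)) M.
Hypothesis q_pos : forall k, exists x : T k, 0 < q x /\ (0 < len x)%N.
Variable d : 'I_r -> R.
Hypothesis d0 : forall k, 0 < d k.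
Hypothesis d_crit : forall k A, has_sum (@q k) A ->
  A * \sum_(j < r | j != k) d j <= d k.

(** The right-hand sides sum to 1 over k, which gives the criterion with a weak inequality at zero
    tilt. *)
Lemma critical_fraction (k : 'I_r) (A : R) : 0 <= A ->
  A * \sum_(j < r | j != k) d j <= d k -> A / (1 + A) <= d k / \sum_(j < r) d j.
Proof.
move=> A0 Ad; rewrite (bigD1 k)//=; set E := \sum_(j < r | j != k) d j in Ad *.
have E0 : 0 <= E by apply: sumr_ge0 => j _; exact: ltW.
have dk := d0 k.
rewrite ler_pdivrMr; last by rewrite ltr_pwDl.
rewrite mulrAC ler_pdivlMr; last by rewrite ltr_pwDl.
by nra.
Qed.

Definition tilted k (s eta : R) (x : T k) : R :=
  q x * expR (s * (eta * (len x)%:R + c x)).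

(** From a value at most 1 at zero tilt, any negative slope leads strictly below 1. The bound on the
    slope is [eta * Nt - Lt], with the tangent weights [1 / W k]; it increases with [eta] as
    [Nt > 0], and [l] is its zero. For [eta > l] the tilt is reversed. *)
Lemma threshold : exists l : R, forall eta, 0 <= eta -> forall tmax, 0 < tmax ->
  (eta < l -> exists2 t, 0 < t <= tmax & exists2 s,
     forall k, has_sum (@tilted k t eta) (s k) & \sum_(k < r) s k / (1 + s k) < 1) /\
  (l < eta -> exists2 t, 0 < t <= tmax & exists2 s,
     forall k, has_sum (@tilted k (- t) eta) (s k) &
       \sum_(k < r) s k / (1 + s k) < 1).
Proof.
have ex k : exists ANL : R * R * R,
  [/\ has_sum (@q k) ANL.1.1, has_sum (fun x : T k => q x * (len x)%:R) ANL.1.2 &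
  forall eta, 0 <= eta -> exists C t0 : R, 0 < t0 /\ forall t, 0 < t <= t0 ->
    (exists2 s, has_sum (@tilted k t eta) s
         & s <= ANL.1.1 + t * (eta * ANL.1.2 - ANL.2) + t ^+ 2 * C) /\
    (exists2 s, has_sum (@tilted k (- t) eta) s
         & s <= ANL.1.1 - t * (eta * ANL.1.2 - ANL.2) + t ^+ 2 * C)].
  have [M qM] := q_exp k.
  have [A [N [L H]]] := tilt_expansion C00 delta0 (@c_len k) qM.
  by exists (A, N, L).
have [F FP] := choice ex.
pose A k := (F k).1.1; pose N k := (F k).1.2; pose L k := (F k).2.
pose W k := (1 + A k) ^+ 2.
have A0 k : 0 <= A k by have [/has_sum_ge0] := FP k.
have W0 k : 0 < W k by rewrite exprn_gt0// ltr_pwDl.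
have N0 k : 0 < N k.
  have [_ [qlen0 qlenN] _] := FP k; have [x [qx lx]] := q_pos k.
  rewrite -lte_fin /N -qlenN.
  apply: lt_le_trans (@esum_term_le _ _ (fun x : T k => (q x * (len x)%:R)%:E) x _).
    by rewrite lte_fin mulr_gt0// ltr0n.
  by move=> y; rewrite lee_fin.
have crit : \sum_(k < r) A k / (1 + A k) <= 1.
  have D0 : 0 < \sum_(j < r) d j.
    by rewrite (bigD1 (Ordinal r0))//= ltr_pwDl// sumr_ge0// => j _; exact: ltW.
  apply: (@le_trans _ _ (\sum_(k < r) d k / \sum_(j < r) d j)).
    apply: ler_sum => k _; apply: critical_fraction => //.
    by apply: d_crit; have [] := FP k.
  by rewrite -mulr_suml divff// gt_eqF.
pose Nt := \sum_(k < r) N k / W k; pose Lt := \sum_(k < r) L k / W k.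
have Nt0 : 0 < Nt.
  rewrite /Nt (bigD1 (Ordinal r0))//= ltr_pwDl ?divr_gt0//.
  by apply: sumr_ge0 => j _; rewrite divr_ge0// ltW.
exists (Lt / Nt) => eta eta0 tmax tmax0.
have ex2 k : exists Ct : R * R, 0 < Ct.2 /\ forall t, 0 < t <= Ct.2 ->
    (exists2 s, has_sum (@tilted k t eta) s
         & s <= A k + t * (eta * N k - L k) + t ^+ 2 * Ct.1) /\
    (exists2 s, has_sum (@tilted k (- t) eta) s
         & s <= A k - t * (eta * N k - L k) + t ^+ 2 * Ct.1).
  by have [_ _ /(_ eta eta0)[C [t0 H]]] := FP k; exists (C, t0).
have [G GP] := choice ex2.
have [t0 t00 t0G] := @fin_common_bound R r (fun k t => t <= (G k).2)
  (fun i x y _ yx => le_trans yx)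
  (fun k => ex_intro2 _ _ (G k).2 (GP k).1 (lexx _)).
have slope : \sum_(k < r) (eta * N k - L k) / W k = eta * Nt - Lt.
  by rewrite /Nt /Lt mulr_sumr -sumrB; apply: eq_bigr => k _; rewrite mulrBl mulrA.
have tm0 : 0 < Num.min tmax t0 by rewrite lt_min tmax0.
split.
- rewrite ltr_pdivlMr// => etal.
  have neg : \sum_(k < r) (eta * N k - L k) / W k < 0 by rewrite slope subr_lt0.
  have [t /andP[tp tm] tH] := subcritical_perturb (fun k => (G k).1) A0 crit neg tm0.
  move: tm; rewrite le_min => /andP[tt1 tt2].
  exists t; first by rewrite tp.
  have /choice[s sP] : forall k, exists s, has_sum (@tilted k t eta) s /\
      s <= A k + t * (eta * N k - L k) + t ^+ 2 * (G k).1.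
    move=> k; have [|[s s1 s2] _] := (GP k).2 t; last by exists s.
    by rewrite tp (le_trans tt2).
  exists s => [k|]; first by case: (sP k).
  apply: tH => k; have [s1 ->] := sP k; rewrite andbT.
  exact: has_sum_ge0 s1.
- rewrite ltr_pdivrMr// => etal.
  have neg : \sum_(k < r) (- (eta * N k - L k)) / W k < 0.
    have -> : \sum_(k < r) (- (eta * N k - L k)) / W k = - (eta * Nt - Lt).
      by rewrite -slope -sumrN; apply: eq_bigr => k _; rewrite mulNr.
    by rewrite oppr_lt0 subr_gt0.
  have [t /andP[tp tm] tH] := subcritical_perturb (fun k => (G k).1) A0 crit neg tm0.
  move: tm; rewrite le_min => /andP[tt1 tt2].
  exists t; first by rewrite tp.
  have /choice[s sP] : forall k, exists s, has_sum (@tilted k (- t) eta) s /\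
      s <= A k - t * (eta * N k - L k) + t ^+ 2 * (G k).1.
    move=> k; have [|_ [s s1 s2]] := (GP k).2 t; last by exists s.
    by rewrite tp (le_trans tt2).
  exists s => [k|]; first by case: (sP k).
  apply: tH => k; have [s1 s2] := sP k; rewrite (has_sum_ge0 s1)/=.
  by rewrite mulrN.
Qed.

End Threshold.

(** * Uniform irreducibility *)

Section Sequences.
Context {R : realType}.

Lemma esum_nat_le (f : nat -> R) (M : R) : (forall n, 0 <= f n) ->
  (forall N, \sum_(n < N) f n <= M) ->
  (\esum_(n in [set: nat]) (f n)%:E <= M%:E)%E.
Proof.
move=> f0 fM; have fE n : (0 <= (f n)%:E)%E by rewrite lee_fin.
rewrite -nneseries_esumT//.
apply: lime_le; first by apply: is_cvg_nneseries => n _ _.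
by apply: nearW => N; rewrite sumEFin lee_fin big_mkord.
Qed.

Lemma convergence_radius_sum (a : nat -> R) : (forall n, 0 <= a n) ->
  (1 < convergence_radius a)%E ->
  exists rho M : R, 1 < rho /\ forall N, \sum_(n < N) a n * rho ^+ n <= M.
Proof.
move=> a0 /ereal_sup_gt[_ [z cz <-]]; rewrite lte_fin => z1.
pose rho := (1 + `|z|) / 2.
have rho1 : 1 < rho by rewrite /rho; lra.
have crho : cvgn (pseries a rho).
  apply: is_cvg_pseries_inside cz _; rewrite ger0_norm; rewrite /rho; lra.
exists rho, (limn (pseries a rho)); split=> // N.
rewrite -(big_mkord xpredT (fun n => a n * rho ^+ n)).
apply: (@nondecreasing_cvgn_le _ (pseries a rho)) => //.
apply: nondecreasing_series => n _ _.
by rewrite mulr_ge0// exprn_ge0// ltW// (lt_trans ltr01).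
Qed.

End Sequences.

Section Irreducibility.
Context {R : realType} {r : nat} {V : 'I_r -> countType}.
Variables (o : forall i, V i) (p : forall i, V i -> V i -> R).
Variable alpha : 'I_r -> R.
Hypothesis p0 : forall i (x y : V i), 0 <= p x y.
Hypothesis alpha0 : forall i, 0 < alpha i.
Hypothesis alpha1 : \sum_(i < r) alpha i = 1.

Local Notation P := (free_product_matrix (o := o) p alpha).

Let P0 := free_product_matrix_ge0 (o := o) p0 (fun i => ltW (alpha0 i)).

Lemma neighbour_coord i (x z : free_product o) :
  prefix_part i (val z) = prefix_part i (val x) ->
  neighbour x (Defs.coord o i (val z)) = z.
Proof.
move=> zx; apply: val_inj; rewrite val_neighbour -zx.
by have [_ _ ->] := append_coord i (valP z).
Qed.

(** The walk may choose factor i at every step, at the price [alpha i] each time, and then stays in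
    the copy of [V i] through [x]. *)
Lemma nstep_neighbour n i (x : free_product o) (v w : V i) :
  ((alpha i ^+ n)%:E * nstep (@p i) n v w <=
   nstep P n (neighbour x v) (neighbour x w))%E.
Proof.
have pi0 := @p0 i.
elim: n v w => [|n IH] v w.
  rewrite /= expr0 mul1e lee_fin.
  by case: (eqVneq v w) => [->|_]; rewrite ?eqxx.
rewrite /= -esumZl; last 2 first.
- by rewrite lee_fin exprn_ge0// ltW.
- by move=> z; rewrite mule_ge0 ?lee_fin// nstep_ge0.
apply: le_trans (@esum_inj_le R _ _ _ (fun z => (P (neighbour x v) z)%:E *
  nstep P n z (neighbour x w))%E (@neighbour_inj _ _ o i x) _); last first.
  by move=> z; rewrite mule_ge0 ?lee_fin// nstep_ge0.
apply: le_esum => c _; rewrite exprS EFinM muleACA -EFinM lee_pmul//.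
- by rewrite lee_fin mulr_ge0// ltW.
- by rewrite mule_ge0 ?nstep_ge0// lee_fin exprn_ge0// ltW.
rewrite lee_fin /free_product_matrix (bigD1 i)//=.
rewrite {1}/lift_matrix !prefix_part_neighbour eqxx !coord_neighbour lerDl.
by apply: sumr_ge0 => j _; rewrite mulr_ge0 ?lift_matrix_ge0// ltW.
Qed.

Hypothesis p_unif : forall i, uniformly_irreducible (@p i).

Lemma free_product_lower : exists2 c : R, 0 < c <= 1 &
  forall n x y, (0 < nstep P n x y)%E ->
  exists k, ((c ^+ n)%:E <= nstep P k x y)%E.
Proof.
have [c c0 cP] : exists2 c : R, 0 < c & forall i, forall v w : V i, 0 < p v w ->
    exists k, (c%:E <= (alpha i ^+ k)%:E * nstep (@p i) k v w)%E.
  apply: fin_common_bound => [i x y y0 yx h v w vw|i].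
    have [k hk] := h v w vw; exists k; apply: le_trans hk.
    by rewrite lee_fin.
  have [eps [K [eps0 H]]] := p_unif i.
  (* The detour has length [k <= K] and [alpha i <= 1], so its cost is at most that of K steps. *)
  exists (alpha i ^+ K * eps); first by rewrite mulr_gt0// exprn_gt0.
  move=> v w vw; have [k kK hk] := H v w vw; exists k.
  have ai0 := ltW (alpha0 i); rewrite EFinM lee_pmul//.
  - by rewrite lee_fin exprn_ge0.
  - by rewrite lee_fin ltW.
  rewrite lee_fin ler_wiXn2l//.
  by rewrite -alpha1 (bigD1 i)//= lerDl sumr_ge0// => j _; exact: ltW.
pose c' := Num.min c 1.
have c'0 : 0 < c' by rewrite lt_min c0 ltr01.
exists c'; first by rewrite c'0 ge_min lexx orbT.
apply: nstep_lower => //; first exact: ltW.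
move=> x y xy.
have [i xyi] : exists i, 0 < alpha i * lift_matrix o p i (val x) (val y).
  apply: contrapT => /forallNP h; move: xy.
  rewrite /free_product_matrix big1 ?ltxx// => i _; apply/eqP.
  rewrite eq_le (mulr_ge0 (ltW (alpha0 i)) (lift_matrix_ge0 _ p0 _ _ _)).
  by rewrite andbT leNgt; apply/negP; exact: h.
have /= : 0 < lift_matrix o p i (val x) (val y) by rewrite pmulr_rgt0 in xyi.
rewrite /lift_matrix; case: eqP => [pxy pp|]; last by rewrite ltxx.
have [k hk] := cP i _ _ pp; exists k.
have := nstep_neighbour k x (Defs.coord o i (val x)) (Defs.coord o i (val y)).
rewrite !neighbour_coord// => h; apply: le_trans h; apply: le_trans hk.
by rewrite lee_fin ge_min lexx.
Qed.

Hypothesis p_reachable : forall i (x : V i),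
  exists n, (0 < nstep (@p i) n (o i) x)%E.

Lemma neighbour_root i : neighbour (empty_word o) (o i) = empty_word o.
Proof. by apply: val_inj; rewrite val_neighbour /append eqxx. Qed.

Lemma letter_reachable i (c : V i) :
  exists n, (0 < visit o p alpha n (append o [::] c))%E.
Proof.
have [n hn] := p_reachable c; exists n.
have := nstep_neighbour n (empty_word o) (o i) c.
rewrite neighbour_root nstep_visit//; last by move=> j; exact: ltW.
rewrite val_neighbour; apply: lt_le_trans.
by rewrite mule_gt0// lte_fin exprn_gt0.
Qed.

End Irreducibility.

(** * The Green function *)

Section GreenFunction.
Context {R : realType} {r : nat} {V : 'I_r -> countType}.
Variables (o : forall i, V i) (p : forall i, V i -> V i -> R).
Variable alpha : 'I_r -> R.
Hypothesis r2 : (2 <= r)%N.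
Hypothesis p0 : forall i (x y : V i), 0 <= p x y.
Hypothesis p1 : forall i (x : V i), (\esum_(y in [set: V i]) (p x y)%:E = 1)%E.
Hypothesis p_noloop : forall i (x : V i), p x x = 0.
Hypothesis alpha0 : forall i, 0 < alpha i.
Hypothesis alpha1 : \sum_(i < r) alpha i = 1.

Let al0 i : 0 <= alpha i. Proof. exact: ltW. Qed.
Let pE0 i (x y : V i) : (0 <= (p x y)%:E)%E. Proof. by rewrite lee_fin. Qed.

Local Notation P := (free_product_matrix (o := o) p alpha).
Local Notation visit := (visit o p alpha).
Local Notation taboo := (taboo o p alpha).
Local Notation level := (level o p alpha).
Local Notation return_via := (return_via o p alpha).

Let v0 := visit_ge0 o p0 al0.
Let t0 := taboo_ge0 o p0 al0.
Let l0 := level_ge0 o p0 al0.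
Let u0 := return_via_ge0 o p0 al0.

Lemma fin_num_le1 (x : \bar R) : (0 <= x)%E -> (x <= 1)%E -> x \is a fin_num.
Proof. by move=> x0 x1; rewrite ge0_fin_numE// (le_lt_trans x1)// ltry. Qed.

Lemma level_fin k n : level k n \is a fin_num.
Proof. by apply: fin_num_le1 => //; exact: level_le1. Qed.

Lemma return_via_fin k n : return_via k n \is a fin_num.
Proof. by apply: fin_num_le1 => //; exact: return_via_le1. Qed.

Lemma visit_fin n (x : free_product o) : visit n (val x) \is a fin_num.
Proof. by apply: fin_num_le1 => //; exact: visit_le1. Qed.

Lemma taboo_le_level n k (c : V k) : c != o k ->
  (taboo n [:: Tagged V c] <= level k n)%E.
Proof.
move=> ck; rewrite /level.
have := @esum_term_le R _ (fun c => if c == o k then 0%E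
  else taboo n [:: Tagged V c]) c.
by rewrite (negPf ck); apply => y; case: ifP.
Qed.

Lemma taboo_fin n k (c : V k) : c != o k ->
  taboo n [:: Tagged V c] \is a fin_num.
Proof.
move=> ck; apply: fin_num_le1 => //.
by apply: le_trans (taboo_le_level n ck) _; exact: level_le1.
Qed.

Let g n := fine (visit n [::]).
Let u j n := fine (return_via j n).
Let b k n := fine (level k n).

Let gE n : visit n [::] = (g n)%:E.
Proof. by rewrite fineK// (visit_fin n (empty_word o)). Qed.
Let uE j n : return_via j n = (u j n)%:E.
Proof. by rewrite fineK// return_via_fin. Qed.
Let bE k n : level k n = (b k n)%:E.
Proof. by rewrite fineK// level_fin. Qed.

(** The balance equation at n = 0: without loops the first step through factor k lands on a letter,
    so nothing returns. *)
Lemma level1 k : b k 1 = alpha k.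
Proof.
apply: EFin_inj; rewrite -bE.
have := level_balance o p0 p1 al0 k 0.
rewrite level0// adde0 mule1 big1 ?adde0; last first.
  by move=> j _; rewrite big_ord1 level0// mul0e.
rewrite /return_via esum1 ?mule0 ?adde0// => c _ /=.
have [->|co] := eqVneq c (o k); first by rewrite p_noloop mule0.
by rewrite /append (negPf co) /= mul0e.
Qed.

Lemma real_balance k n :
  b k n.+1 + u k n = alpha k * ((n == 0)%:R + b k n) +
  \sum_(j < r | j != k) \sum_(m < n.+1) b k m * u j (n - m).
Proof.
apply: EFin_inj; rewrite EFinD -bE -uE level_balance// EFinD EFinM EFinD -bE.
congr (_ + _)%E; rewrite -sumEFin; apply: eq_bigr => j _.
by rewrite -sumEFin; apply: eq_bigr => m _; rewrite EFinM -bE -uE.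
Qed.

Lemma real_return n : g n.+1 = \sum_(m < n.+1) g m * \sum_(j < r) u j (n - m).
Proof.
apply: EFin_inj; rewrite -gE visit_nilS// -sumEFin; apply: eq_bigr => m _.
rewrite EFinM -gE -sumEFin; congr (_ * _)%E.
by apply: eq_bigr => j _; rewrite -uE.
Qed.

Hypothesis R_gt1 : (1 < green_radius P)%E.

Lemma renewal_data : exists (d : 'I_r -> R) (rho M : R),
  [/\ forall k, 0 < d k,
      forall k N, (\sum_(n < N) b k n) * \sum_(j < r | j != k) d j <= d k,
      1 < rho,
      forall N, \sum_(n < N) g n * rho ^+ n <= M &
      forall k N, \sum_(n < N) b k n * rho ^+ n <= M].
Proof.
have [rho0 [Gam [rho01 gG]]] : exists rho M : R,
    1 < rho /\ forall N, \sum_(n < N) g n * rho ^+ n <= M.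
  apply: convergence_radius_sum; first by move=> n; rewrite fine_ge0.
  apply: lt_le_trans R_gt1 _; apply: ereal_inf_lbound.
  exists (empty_word o, empty_word o) => //.
  by congr convergence_radius; apply/funext => n; rewrite nstep_visit.
have u0' j n : 0 <= u j n by rewrite fine_ge0.
have b0' k n : 0 <= b k n by rewrite fine_ge0.
have g0' n : 0 <= g n by rewrite fine_ge0.
have b_0 k : b k 0 = 0 by rewrite /b level0.
have b_1 k : 0 < b k 1 by rewrite level1.
have g_0 : g 0 = 1 by [].
have [rho [M [rho1 rho_le bM]]] := level_exp_moment r2 alpha0 alpha1 u0' b0' g0'
  b_0 b_1 real_balance g_0 real_return rho01 gG.
exists (escape alpha u), rho, (Num.max M Gam); split=> //.
- by move=> k; exact: (escape_gt0 alpha0 alpha1 u0' b0' g0' b_0 b_1 real_balance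
    g_0 real_return rho01 gG).
- by move=> k N; exact: (level_escape alpha0 alpha1 u0' b0' b_0 real_balance).
- move=> N; rewrite le_max; apply/orP; right; apply: le_trans (gG N).
  apply: ler_sum => n _; apply: ler_wpM2l => //.
  by rewrite lerXn2r// nnegrE ltW// (lt_trans ltr01).
- by move=> k N; rewrite le_max bM.
Qed.

(** * Green and last-exit generating functions up to [rho] *)

Section Radius.
Variables (rho M : R).
Hypothesis rho1 : 1 < rho.
Hypothesis gM : forall N, \sum_(n < N) g n * rho ^+ n <= M.
Hypothesis bM : forall k N, \sum_(n < N) b k n * rho ^+ n <= M.

Let rho0 : 0 <= rho. Proof. by rewrite ltW// (lt_trans ltr01). Qed.

Lemma genfun_ge0 (f : nat -> \bar R) z : (forall n, 0 <= f n)%E -> 0 <= z ->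
  (0 <= genfun f z)%E.
Proof.
move=> f0 z0; apply: esum_ge0 => n _.
by rewrite mule_ge0// lee_fin exprn_ge0.
Qed.

Lemma genfun_le (f : nat -> \bar R) (a : nat -> R) z :
  (forall n, 0 <= f n)%E -> (forall n, f n <= (a n)%:E)%E ->
  (forall N, \sum_(n < N) a n * rho ^+ n <= M) -> 0 <= z <= rho ->
  (genfun f z <= M%:E)%E.
Proof.
move=> f0 fa aM /andP[z0 zr].
have a0 n : 0 <= a n by rewrite -lee_fin; apply: le_trans (fa n).
apply: (@le_trans _ _ (\esum_(n in [set: nat]) (a n * rho ^+ n)%:E)%E).
  apply: le_esum => n _; rewrite EFinM lee_pmul// lee_fin ?exprn_ge0//.
  by rewrite lerXn2r.
by apply: esum_nat_le => // n; rewrite mulr_ge0// exprn_ge0.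
Qed.

(** [fine] sends +oo to 0, so the value is meaningful only where the series is finite;
    [green_factor] shows this for reduced words and [z <= rho], [last_exitE] for single letters. *)
Definition green z x : R := fine (genfun (visit ^~ x) z).
Definition last_exit z y : R := fine (genfun (taboo ^~ [:: y]) z).

Lemma green_nilE z : 0 <= z <= rho ->
  genfun (visit ^~ [::]) z = (green z [::])%:E.
Proof.
move=> zr; rewrite fineK// ge0_fin_numE.
  apply: le_lt_trans (ltry M); apply: genfun_le gM zr => // n.
  by rewrite gE.
by apply: genfun_ge0 => //; case/andP: zr.
Qed.

Lemma genfun_letter_le z k (c : V k) : 0 <= z <= rho -> c != o k ->
  (genfun (taboo ^~ [:: Tagged V c]) z <= M%:E)%E.
Proof.
move=> zr ck; apply: genfun_le (bM k) zr => // n.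
by rewrite -bE taboo_le_level.
Qed.

Lemma last_exitE z k (c : V k) : 0 <= z <= rho -> c != o k ->
  genfun (taboo ^~ [:: Tagged V c]) z = (last_exit z (Tagged V c))%:E.
Proof.
move=> zr ck; rewrite fineK// ge0_fin_numE.
  exact: le_lt_trans (genfun_letter_le zr ck) (ltry M).
by apply: genfun_ge0 => //; case/andP: zr.
Qed.

Lemma last_exit_ge0 z y : 0 <= z -> 0 <= last_exit z y.
Proof. by move=> z0; rewrite fine_ge0// genfun_ge0. Qed.

Lemma green_ge0 z x : 0 <= z -> 0 <= green z x.
Proof. by move=> z0; rewrite fine_ge0// genfun_ge0. Qed.

Lemma green_factor z x : 0 <= z <= rho -> reduced o x ->
  (genfun (visit ^~ x) z = (green z [::] * \prod_(y <- x) last_exit z y)%:E)%E.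
Proof.
move=> zr; have /andP[z0 _] := zr; elim/last_ind: x => [|x y IH].
  by rewrite big_nil mulr1 green_nilE.
rewrite reduced_rcons => /and3P[rx yo _]; rewrite genfun_rcons// IH//.
by case: y yo => k c /= ck; rewrite last_exitE// -cats1 big_cat big_seq1/= mulrA.
Qed.


Hypothesis p_reachable : forall i (x : V i),
  exists n, (0 < nstep (@p i) n (o i) x)%E.
Hypothesis p_unif : forall i, uniformly_irreducible (@p i).

Let one_in : 0 <= (1 : R) <= rho. Proof. by rewrite ler01 ltW. Qed.

Lemma greenE x : reduced o x ->
  green 1 x = green 1 [::] * \prod_(y <- x) last_exit 1 y.
Proof. by move=> rx; rewrite /green green_factor. Qed.

Lemma visit_le_green n x : reduced o x -> (visit n x <= (green 1 x)%:E)%E.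
Proof.
move=> rx; rewrite greenE// -green_factor//.
have := @esum_term_le R _ (fun n => visit n x * (1 ^+ n)%:E)%E n.
by rewrite expr1n mule1; apply => m; rewrite expr1n mule1.
Qed.

Lemma green_nil_ge1 : 1 <= green 1 [::].
Proof. by have := @visit_le_green 0 [::] isT; rewrite /= lee_fin. Qed.

Lemma green_nil_gt0 : 0 < green 1 [::].
Proof. exact: lt_le_trans ltr01 green_nil_ge1. Qed.

Lemma reduced_letter k (c : V k) : c != o k -> reduced o [:: Tagged V c].
Proof. by move=> ck; rewrite /reduced /= ck. Qed.

Lemma green_letter k (c : V k) : c != o k ->
  green 1 [:: Tagged V c] = green 1 [::] * last_exit 1 (Tagged V c).
Proof. by move=> ck; rewrite greenE ?reduced_letter// big_seq1. Qed.

Lemma last_exit_gt0 k (c : V k) : c != o k -> 0 < last_exit 1 (Tagged V c).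
Proof.
move=> ck; have [n] := letter_reachable p0 alpha0 p_reachable c.
rewrite {1}/append (negPf ck) /= => vn.
have := lt_le_trans vn (visit_le_green n (reduced_letter ck)).
by rewrite lte_fin green_letter// pmulr_rgt0// green_nil_gt0.
Qed.

Lemma last_exit_le k (c : V k) : c != o k -> last_exit 1 (Tagged V c) <= M.
Proof.
by move=> ck; rewrite -lee_fin -last_exitE//; exact: genfun_letter_le.
Qed.

(* Uniform irreducibility bounds the Green function at a letter from below by
   c ^ n as soon as the letter can be reached in n steps. *)
Lemma ln_last_exit_bound : exists2 C : R, 0 <= C &
  forall n k (c : V k), c != o k -> (0 < taboo n [:: Tagged V c])%E ->
  `|ln (last_exit 1 (Tagged V c))| <= C * (n%:R + 1).
Proof.
have [e /andP[e0 e1] eP] :=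
  free_product_lower o p0 alpha0 alpha1 p_unif.
pose G := green 1 [::].
exists (`|ln e| + `|ln G| + `|ln M|) => [|n k c ck tn]; first by rewrite !addr_ge0.
set Q := last_exit 1 _.
have Q0 : 0 < Q by exact: last_exit_gt0.
have M0 : 0 < M by exact: lt_le_trans Q0 (last_exit_le ck).
have upper : ln Q <= `|ln M|.
  by apply: le_trans (ler_norm _); rewrite ler_ln ?posrE// last_exit_le.
have lower : - (n%:R * `|ln e| + `|ln G|) <= ln Q.
  have [m hm] : exists m, ((e ^+ n)%:E <= visit m [:: Tagged V c])%E.
    have := eP n (empty_word o) (neighbour (empty_word o) c).
    rewrite nstep_visit// val_neighbour /append (negPf ck) /= => h.
    have [|m] := h; first exact: lt_le_trans tn (taboo_le_visit _ p0 al0 _ _).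
    rewrite nstep_visit// val_neighbour /append (negPf ck) /= => h'.
    by exists m.
  have := le_trans hm (visit_le_green m (reduced_letter ck)).
  rewrite lee_fin green_letter// -/G -/Q => h.
  have en : 0 < e ^+ n by rewrite exprn_gt0.
  have : ln (e ^+ n) <= ln (G * Q).
    by rewrite ler_ln ?posrE// mulr_gt0// green_nil_gt0.
  rewrite lnM ?posrE ?green_nil_gt0// lnXn// => h2.
  have := ler_norm (ln G); have := ler_norm (- ln e); rewrite normrN => h3 h4.
  have : - (`|ln e| *+ n) <= ln e *+ n.
    by rewrite -mulNrn lerMn2r lerNl h3 orbT.
  rewrite mulr_natl; lra.
rewrite ler_norml; apply/andP; split.
  apply: le_trans lower; rewrite lerN2.
  have n0 : 0 <= n%:R :> R by [].
  have := normr_ge0 (ln e); have := normr_ge0 (ln G); have := normr_ge0 (ln M).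
  nra.
apply: le_trans upper _.
have n0 : 0 <= n%:R :> R by [].
have := normr_ge0 (ln e); have := normr_ge0 (ln G); have := normr_ge0 (ln M).
nra.
Qed.

Let T k : choiceType := (nat * V k)%type.

(** Time and letter are kept as a joint index: the tilt acts on the time through [eta] and on the
    letter through its cost, and summing out the time recovers [last_exit]. *)
Definition letter_mass k (x : nat * V k) : R :=
  if x.2 == o k then 0 else fine (taboo x.1 [:: Tagged V x.2]).

Definition letter_cost k (x : nat * V k) : R :=
  ln (last_exit 1 (Tagged V x.2)).

Lemma letter_mass_ge0 k x : 0 <= @letter_mass k x.
Proof. by rewrite /letter_mass; case: ifP => // _; rewrite fine_ge0. Qed.

Lemma letter_massE k n (c : V k) : (letter_mass (n, c))%:E =
  (if c == o k then 0 else taboo n [:: Tagged V c])%E.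
Proof.
by rewrite /letter_mass /=; case: eqVneq => // ck; rewrite fineK// taboo_fin.
Qed.

Lemma letter_mass_sum k (z : R) : 0 <= z ->
  (\esum_(x in [set: T k]) (letter_mass x * z ^+ x.1)%:E =
   \esum_(n in [set: nat]) (b k n * z ^+ n)%:E)%E.
Proof.
move=> z0; rewrite -(esum_pair
  (f := fun n c => (letter_mass (n, c) * z ^+ n)%:E)); last first.
  by move=> n c; rewrite lee_fin mulr_ge0 ?letter_mass_ge0// exprn_ge0.
apply: eq_esum => n _; under eq_esum do rewrite EFinM.
rewrite esumZr ?lee_fin ?exprn_ge0//; last first.
  by move=> c; rewrite lee_fin letter_mass_ge0.
rewrite EFinM -bE; congr (_ * _)%E; apply: eq_esum => c _.
exact: letter_massE.
Qed.

Let b0' k n : 0 <= b k n. Proof. by rewrite fine_ge0. Qed.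

Lemma letter_mass_exp k : exists S,
  has_sum (fun x : T k => letter_mass x * expR (ln rho * (x.1)%:R)) S.
Proof.
have e n : expR (ln rho * n%:R) = rho ^+ n.
  by rewrite mulrC expRM_natl lnK// posrE (lt_trans ltr01).
have [||S hS _] := @has_sum_bounded R (T k)
  (fun x => letter_mass x * expR (ln rho * (x.1)%:R)) M.
- by move=> x; rewrite mulr_ge0 ?letter_mass_ge0// expR_ge0.
- under eq_esum do rewrite e.
  rewrite letter_mass_sum//; apply: esum_nat_le => // n.
  by rewrite mulr_ge0// exprn_ge0.
- by exists S.
Qed.

Lemma letter_mass_pos k : exists x : T k, 0 < letter_mass x /\ (0 < x.1)%N.
Proof.
have : (level k 1 != 0)%E.
  by rewrite bE level1 eqe gt_eqF.
move=> h; have [c hc] : exists c : V k, letter_mass (1%N, c) != 0.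
  apply: contrapT => /forallNP hc; move/eqP: h; apply; apply: esum1 => c _.
  rewrite -letter_massE; congr EFin; apply/eqP.
  exact/negPn/negP/hc.
by exists (1%N, c); split=> //; rewrite lt_def hc letter_mass_ge0.
Qed.

(** Summing over the time n first turns the factor exp(s eta n) into the argument exp(s eta) of L,
    leaving the letter weight L(c|exp(s eta)) L(c|1)^s. *)
Lemma tilted_letters k (s eta S : R) : expR (s * eta) <= rho ->
  has_sum (@tilted R r T letter_mass letter_cost (fun k x => x.1) k s eta) S ->
  has_sum (fun c : V k => if c == o k then 0 else
    last_exit (expR (s * eta)) (Tagged V c) *
    expR (s * ln (last_exit 1 (Tagged V c)))) S.
Proof.
set z := expR _ => zr [_ hS].
have z0 : 0 <= z by exact: expR_ge0.
split=> [c|].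
  by case: ifP => // _; rewrite mulr_ge0 ?expR_ge0// last_exit_ge0.
rewrite -hS -(esum_pair (f := fun n c => (@tilted R r T letter_mass letter_cost
  (fun k x => x.1) k s eta (n, c))%:E)); last first.
  by move=> n c; rewrite lee_fin mulr_ge0 ?letter_mass_ge0 ?expR_ge0.
rewrite esum_swap; last first.
  by move=> n c; rewrite lee_fin mulr_ge0 ?letter_mass_ge0 ?expR_ge0.
apply: eq_esum => c _; case: eqVneq => [->|ck].
  by rewrite esum1// => n _; rewrite /tilted /letter_mass/= eqxx mul0r.
rewrite EFinM -last_exitE ?z0//; rewrite /genfun -esumZr; last 2 first.
- by rewrite lee_fin expR_ge0.
- by move=> n; rewrite mule_ge0// lee_fin exprn_ge0.
apply: eq_esum => n _; rewrite /tilted EFinM letter_massE (negPf ck) -muleA.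
congr (_ * _)%E; rewrite -EFinM; congr EFin.
by rewrite /letter_cost /= mulrDr expRD -expRM_natl; congr (expR _ * _); ring.
Qed.

Lemma green_expR s x : reduced o x ->
  expR (s * ln (green 1 x)) = expR (s * ln (green 1 [::])) *
    \prod_(y <- x) expR (s * ln (last_exit 1 y)).
Proof.
move=> rx; have [<- _] : expR (s * ln (green 1 [::])) *
    \prod_(y <- x) expR (s * ln (last_exit 1 y)) = expR (s * ln (green 1 x)) /\
    0 < green 1 x; last by [].
elim/last_ind: x rx => [|x y IH].
  by rewrite big_nil mulr1 green_nil_gt0.
move=> rxy; have := rxy; rewrite reduced_rcons => /and3P[rx yo _].
rewrite (greenE rxy) -!cats1 !big_cat !big_seq1/= !mulrA -(greenE rx).
have [-> gx] := IH rx; case: y yo {rxy} => k c /= ck.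
have Q0 := last_exit_gt0 ck.
by rewrite lnM ?posrE// mulrDr expRD mulr_gt0.
Qed.

(** After swapping the sums, the sum over n is G(x|z) with z = exp(s eta). Both G(x|z) and G(x|1)^s
    factor over letters, so the word criterion applies. *)
Lemma tilted_words_finite (s eta : R) (S : 'I_r -> R) :
  expR (s * eta) <= rho ->
  (forall k, has_sum
    (@tilted R r T letter_mass letter_cost (fun k x => x.1) k s eta) (S k)) ->
  \sum_(k < r) S k / (1 + S k) < 1 ->
  (\esum_(n in [set: nat]) \esum_(x in [set: free_product o])
    (visit n (val x) *
     (expR (s * (eta * n%:R + ln (green 1 (val x)))))%:E) < +oo)%E.
Proof.
move=> zr hS Slt; set z := expR (s * eta) in zr.
have z0 : 0 <= z by exact: expR_ge0.
pose w y := last_exit z y * expR (s * ln (last_exit 1 y)).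
have w0 y : 0 <= w y by rewrite mulr_ge0 ?expR_ge0// last_exit_ge0.
have fin := reduced_words_sum w0 (fun k => tilted_letters zr (hS k)) Slt.
rewrite esum_swap; last first.
  by move=> n x; rewrite mule_ge0// lee_fin expR_ge0.
pose C := green z [::] * expR (s * ln (green 1 [::])).
rewrite (eq_esum (b := fun x => C%:E * (\prod_(y <- val x) w y)%:E)%E).
  rewrite esumZl.
  - apply: lte_mul_pinfty => //; rewrite lee_fin mulr_ge0 ?expR_ge0//.
    exact: green_ge0.
  - by rewrite lee_fin mulr_ge0 ?expR_ge0// green_ge0.
  - by move=> x; rewrite lee_fin; apply: prodr_ge0 => y _.
move=> x _; have rx := valP x.
transitivity (genfun (visit ^~ (val x)) z * (expR (s * ln (green 1 (val x))))%:E)%E.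
  rewrite /genfun -esumZr; last 2 first.
  - by rewrite lee_fin expR_ge0.
  - by move=> n; rewrite mule_ge0// lee_fin exprn_ge0.
  apply: eq_esum => n _; rewrite -muleA -EFinM; congr (_ * EFin _)%E.
  by rewrite mulrDr expRD -expRM_natl; congr (expR _ * _); ring.
rewrite green_factor ?z0// green_expR// -!EFinM; congr EFin.
by rewrite /w big_split/= /C; ring.
Qed.

Variable d : 'I_r -> R.
Hypothesis d0 : forall k, 0 < d k.
Hypothesis d_crit : forall k N,
  (\sum_(n < N) b k n) * \sum_(j < r | j != k) d j <= d k.

Lemma letter_mass_crit k A : has_sum (@letter_mass k) A ->
  A * \sum_(j < r | j != k) d j <= d k.
Proof.
move=> [_ hA]; have [->|En0] := eqVneq (\sum_(j < r | j != k) d j) 0.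
  by rewrite mulr0 ltW.
have E0 : 0 < \sum_(j < r | j != k) d j.
  by rewrite lt_def En0 sumr_ge0// => j _; exact: ltW.
rewrite -ler_pdivlMr// -lee_fin -hA.
have -> : (\esum_(x in [set: nat * V k]) (letter_mass x)%:E =
    \esum_(n in [set: nat]) (b k n)%:E)%E.
  have := @letter_mass_sum k 1 ler01.
  under eq_esum do rewrite expr1n mulr1.
  by move=> ->; apply: eq_esum => n _; rewrite expr1n mulr1.
by apply: esum_nat_le => // N; rewrite ler_pdivlMr.
Qed.

Lemma damped_words_finite (kappa : R) : 0 < kappa ->
  (\esum_(x in [set: free_product o])
    (green 1 (val x) * expR (- kappa * (size (val x))%:R))%:E < +oo)%E.
Proof.
move=> kappa0; pose e := expR (- kappa).
have e0 : 0 < e by exact: expR_gt0.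
have e1 : e < 1 by rewrite expR_lt1 oppr_lt0.
have /choice[A hA] : forall k, exists A, has_sum (@letter_mass k) A.
  move=> k; have [S hS] := letter_mass_exp k.
  have [A hA _] : exists2 A, has_sum (@letter_mass k) A & A <= S.
    apply: has_sum_dom hS => x; rewrite letter_mass_ge0/=.
    rewrite ler_peMr ?letter_mass_ge0// -expR0 ler_expR mulr_ge0//.
    by rewrite ln_ge0// ltW.
  by exists A.
have A0 k : 0 < A k.
  have [x [qx _]] := letter_mass_pos k; have [q0 qA] := hA k.
  rewrite -lte_fin -qA; apply: lt_le_trans
    (@esum_term_le R _ (fun x : T k => (letter_mass x)%:E) x _).
    by rewrite lte_fin.
  by move=> y; rewrite lee_fin.
have hQ k : has_sum (fun c : V k => if c == o k then 0 else
    last_exit 1 (Tagged V c)) (A k).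
  have := @tilted_letters k 0 0 (A k).
  rewrite !mul0r expR0 => /(_ (ltW rho1)).
  have -> : @tilted R r T letter_mass letter_cost (fun k x => x.1) k 0 0 =
      @letter_mass k.
    by apply/funext => x; rewrite /tilted mul0r expR0 mulr1.
  move=> /(_ (hA k)); congr has_sum.
  by apply/funext => c; rewrite mul0r expR0 mulr1.
pose w y := e * last_exit 1 y.
have w0 y : 0 <= w y by rewrite mulr_ge0 ?last_exit_ge0// ltW.
have hw k : has_sum (fun c : V k => if c == o k then 0 else w (Tagged V c))
    (e * A k).
  have := has_sumZ (ltW e0) (hQ k); congr has_sum; apply/funext => c.
  by case: ifP => _; rewrite ?mulr0.
(* Damping multiplies each letter by [e < 1], which makes the weak bound of [critical_fraction]
   strict because [A k > 0]. *)
have sub : \sum_(k < r) (e * A k) / (1 + e * A k) < 1.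
  have r0 : (0 < r)%N by apply: leq_trans r2.
  have D0 : 0 < \sum_(j < r) d j.
    by rewrite (bigD1 (Ordinal r0))//= ltr_pwDl// sumr_ge0// => j _; exact: ltW.
  apply: (@lt_le_trans _ _ (\sum_(k < r) d k / \sum_(j < r) d j)); last first.
    by rewrite -mulr_suml divff// gt_eqF.
  apply: ltr_sum.
    by apply/hasP; exists (Ordinal r0) => //; rewrite mem_index_enum.
  move=> k _; apply: lt_le_trans
    (critical_fraction d0 (ltW (A0 k)) (letter_mass_crit (hA k))).
  have Ak := A0 k.
  rewrite ltr_pdivrMr; last by rewrite ltr_pwDl// mulr_ge0// ltW.
  rewrite mulrAC ltr_pdivlMr; last by rewrite ltr_pwDl// ltW.
  by nra.
have fin := reduced_words_sum w0 hw sub.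
rewrite (eq_esum (b := fun x => (green 1 [::])%:E * (\prod_(y <- val x) w y)%:E)%E).
  rewrite esumZl ?lee_fin ?green_ge0//.
    by apply: lte_mul_pinfty => //; rewrite lee_fin green_ge0.
  by move=> x; rewrite lee_fin; apply: prodr_ge0 => y _.
move=> x _; rewrite -EFinM; congr EFin; rewrite greenE ?(valP x)// -mulrA.
congr (_ * _); rewrite /w big_split/= mulrC; congr (_ * _).
by rewrite mulrC expRM_natl -/e big_const_seq count_predT iter_mulr_1.
Qed.

Lemma green_threshold_radius : exists l : R, forall eta, 0 <= eta ->
  (eta < l -> exists2 t, 0 < t &
    (\esum_(n in [set: nat]) \esum_(x in [set: free_product o])
     (visit n (val x) *
      (expR (t * (eta * n%:R + ln (green 1 (val x)))))%:E) < +oo)%E) /\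
  (l < eta -> exists2 t, 0 < t &
    (\esum_(n in [set: nat]) \esum_(x in [set: free_product o])
     (visit n (val x) *
      (expR (- t * (eta * n%:R + ln (green 1 (val x)))))%:E) < +oo)%E).
Proof.
have [C C0 Cb] := ln_last_exit_bound.
have lr0 : 0 < ln rho by rewrite ln_gt0.
have r0 : (0 < r)%N by apply: leq_trans r2.
have cl k (x : T k) : 0 < letter_mass x ->
    `|letter_cost x| <= C * ((x.1)%:R + 1).
  rewrite /letter_mass; case: ifPn => [|ck]; first by rewrite ltxx.
  by move=> h; apply: Cb => //; rewrite -lte_fin fineK ?taboo_fin in h.
have [l lP] := @threshold R r T letter_mass letter_cost (fun k x => x.1) C
  (ln rho) C0 lr0 r0 cl letter_mass_exp letter_mass_pos d d0 letter_mass_crit.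
exists l => eta eta0.
(* This cap on t ensures exp(t eta) <= [rho]; adding 1 covers [eta = 0]. For negative tilt exp(- t
   eta) <= 1 holds anyway. *)
have tm0 : 0 < ln rho / (eta + 1) by rewrite divr_gt0// ltr_wpDl.
have [lo up] := lP eta eta0 _ tm0; split.
  move=> /lo[t /andP[t0' tm] [S hS Slt]]; exists t => //.
  apply: tilted_words_finite hS Slt.
  rewrite -[leRHS]lnK ?posrE ?(lt_trans ltr01)// ler_expR.
  move: tm; rewrite ler_pdivlMr ?ltr_wpDl//.
  by apply: le_trans; rewrite ler_pM2l// lerDl.
move=> /up[t /andP[t0' _] [S hS Slt]]; exists t => //.
apply: tilted_words_finite hS Slt; apply: le_trans (ltW rho1).
by rewrite -expR0 ler_expR mulNr oppr_le0 mulr_ge0// ltW.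
Qed.

End Radius.

End GreenFunction.

(** * Almost sure lower limits *)

Section LimInf.
Context {R : realType}.
Local Open Scope ereal_scope.

Lemma limn_einf_ge (u : nat -> \bar R) (x : \bar R) N :
  (forall n, (N <= n)%N -> x <= u n) -> x <= limn_einf u.
Proof.
move=> xu; rewrite limn_einf_lim; apply: lime_ge; first exact: is_cvg_einfs.
exists N => // m /= Nm; apply: le_ereal_inf_tmp => _ [k /= mk <-].
by apply: xu; apply: leq_trans mk.
Qed.

Lemma limn_esup_le (u : nat -> \bar R) (x : \bar R) N :
  (forall n, (N <= n)%N -> u n <= x) -> limn_esup u <= x.
Proof.
move=> xu; rewrite limn_esup_lim; apply: lime_le; first exact: is_cvg_esups.
exists N => // m /= Nm; apply: ge_ereal_sup => _ [k /= mk <-].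
by apply: xu; apply: leq_trans mk.
Qed.

Lemma cvg_of_limn (u : nat -> \bar R) (l : \bar R) :
  l <= limn_einf u -> limn_esup u <= l -> u @ \oo --> l.
Proof.
move=> lu ul.
have le1 := limn_einf_sup u.
have eu : limn_einf u = l.
  by apply/eqP; rewrite eq_le lu andbT (le_trans le1).
have su : limn_esup u = l.
  by apply/eqP; rewrite eq_le ul (le_trans lu).
apply: (@squeeze_cvge _ _ _ _ (einfs u) _ (esups u)).
- apply: nearW => n; apply/andP; split.
    by apply: ereal_inf_lbound; exists n => /=.
  by apply: ereal_sup_ubound; exists n => /=.
- by rewrite -eu limn_einf_lim; exact: is_cvg_einfs.
- by rewrite -su limn_esup_lim; exact: is_cvg_esups.
Qed.

Context {d : measure_display} {Omega : measurableType d}.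
Variable Pr : probability Omega R.
Variables (Y : nat -> Omega -> R) (l : R).
Hypothesis mY : forall n, measurable_fun [set: Omega] (Y n).
Hypothesis Y0 : forall n w, (0 <= Y n w)%R.
Hypothesis l0 : (0 <= l)%R.
Hypothesis lower : {ae Pr, forall w, forall m : nat, exists N,
  forall n, (N <= n)%N -> (l - m.+1%:R^-1 <= Y n w)%R}.
Hypothesis upper : forall e : R, (0 < e)%R -> exists N, forall n, (N <= n)%N ->
  \int[Pr]_w (Y n w)%:E <= (l + e)%:E.

(* The bound on the expectations forces, through Fatou, the almost sure lower
   bound on the lower limit to be an equality. *)
Lemma liminf_of_expectation :
  (fun n => \int[Pr]_w (Y n w)%:E) @ \oo --> l%:E /\
  {ae Pr, forall w, limn_einf (fun n => (Y n w)%:E) = l%:E}.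
Proof.
have mYE n : measurable_fun [set: Omega] (EFin \o Y n).
  exact/measurable_EFinP.
pose F w := limn_einf (fun n => (Y n w)%:E).
have F0 w : 0 <= F w.
  by apply: (@limn_einf_ge _ _ 0) => n _; rewrite lee_fin.
have Fl : {ae Pr, forall w, l%:E <= F w}.
  apply: filterS lower => w H; apply/lee_subgt0Pr => e e0.
  have [m me] : exists m : nat, (m.+1%:R^-1 <= e)%R.
    exists (Num.truncn e^-1); rewrite -[leRHS]invrK lef_pV2 ?posrE ?invr_gt0//.
    by rewrite ltW// truncnS_gt.
  have [N hN] := H m; apply: (@limn_einf_ge _ _ N) => n Nn.
  rewrite -EFinB lee_fin; apply: le_trans (hN n Nn).
  by rewrite lerD2l lerN2.
have mF : measurable_fun setT F.
  apply: (@measurableT_comp _ _ _ _ _ _ (fun x => - x)).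
    exact: oppe_measurable.
  apply: measurable_fun_limn_esup => n.
  apply: (@measurableT_comp _ _ _ _ _ _ (fun x => - x)).
    exact: oppe_measurable.
  exact: mYE.
(* Almost surely F = l + H; Fatou and the upper bound then force the nonnegative H to have integral
   0. *)
pose H w := maxe (F w - l%:E) 0.
have mH : measurable_fun setT H.
  apply: measurable_maxe; last exact: measurable_cst.
  by apply: emeasurable_funB.
have H0 w : 0 <= H w by rewrite le_max lexx orbT.
have IFH : \int[Pr]_w F w = l%:E + \int[Pr]_w H w.
  transitivity (\int[Pr]_w (l%:E + H w)); last first.
    rewrite ge0_integralD//.
    rewrite (integral_cst Pr measurableT l%:E).
    by rewrite [X in _ * X](_ : _ = 1) ?mule1//; exact: probability_setT.
  apply: ge0_ae_eq_integral => //.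
  - by apply: emeasurable_funD.
  - by move=> w _; rewrite adde_ge0// lee_fin.
  apply: filterS Fl => w lF _; rewrite /H max_l; last by rewrite sube_ge0.
  by rewrite addeC subeK.
have Ifat : \int[Pr]_w F w <= limn_einf (fun n => \int[Pr]_w (Y n w)%:E).
  by apply: fatou => // n w _; rewrite lee_fin.
have Isup : limn_esup (fun n => \int[Pr]_w (Y n w)%:E) <= l%:E.
  apply/lee_addgt0Pr => e e0; have [N hN] := upper e0.
  by apply: (@limn_esup_le _ _ N).
have IH0 : 0 <= \int[Pr]_w H w by apply: integral_ge0.
split.
  apply: cvg_of_limn => //; apply: le_trans Ifat.
  by rewrite IFH leeDl.
have IH : \int[Pr]_w H w = 0.
  apply/eqP; rewrite eq_le IH0 andbT -(leeD2lE (x := l%:E))// adde0 -IFH.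
  apply: le_trans Ifat _; apply: le_trans (limn_einf_sup _) _.
  exact: Isup.
have /ae_eq_integral_abs : measurable_fun setT H by [].
move=> /(_ Pr measurableT)[h _].
have aeH : ae_eq Pr setT H (cst 0).
  by apply: h; rewrite -[RHS]IH; apply: eq_integral => w _; rewrite gee0_abs.
apply: filterS2 Fl aeH => w lF /(_ Logic.I) Hw.
apply/eqP; rewrite eq_le lF andbT -sube_le0.
have <- : H w = 0 by exact: Hw.
by rewrite le_max lexx.
Qed.

End LimInf.

(** * Laws of Markov chains on countable spaces *)

Section DiscreteVariable.
Context {R : realType} {d : measure_display} {Omega : measurableType d}.
Variable Pr : probability Omega R.
Context {S : countType}.
Variable Z : Omega -> S.
Hypothesis mZ : forall s, measurable (Z @^-1` [set s]).
Local Open Scope ereal_scope.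

(** [S] carries no sigma-algebra; coding by [pickle] gives a measurable partition of [Omega] indexed
    by nat. *)
Let F (n : nat) : set Omega := [set w | pickle (Z w) = n].

Let F_pickle s : F (pickle s) = Z @^-1` [set s].
Proof.
apply/seteqP; split=> w; rewrite /F /=; last by move=> ->.
by move=> /(pcan_inj pickleK).
Qed.

Let F_out n : ~ (exists s : S, n = pickle s) -> F n = set0.
Proof.
move=> ns; apply/seteqP; split=> w //= wn.
by apply: ns; exists (Z w).
Qed.

Let mF n : measurable (F n).
Proof.
have [[s ->]|/F_out ->] := pselect (exists s : S, n = pickle s).
  by rewrite F_pickle.
exact: measurable0.
Qed.

Let F_cover : \bigcup_n F n = setT.
Proof. by apply/seteqP; split=> w // _; exists (pickle (Z w)). Qed.

Let F_triv : trivIset setT F.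
Proof. by move=> i j _ _ [w [/= <- <-]]. Qed.

Lemma measurable_discrete (A : set S) : measurable (Z @^-1` A).
Proof.
rewrite (_ : _ @^-1` _ = \bigcup_(n in [set n | exists2 s, A s & n = pickle s]) F n).
  exact: bigcup_measurable.
apply/seteqP; split=> w /=; first by move=> Aw; exists (pickle (Z w)) => //; exists (Z w).
by move=> [n [s As ->]]; rewrite F_pickle => /= ->.
Qed.

Lemma integral_discrete (f : S -> \bar R) : (forall s, 0 <= f s) ->
  \int[Pr]_w f (Z w) =
  \esum_(s in [set: S]) (Pr (Z @^-1` [set s]) * f s).
Proof.
move=> f0.
have mf : measurable_fun [set: Omega] (fun w => f (Z w)).
  by move=> _ Y mY; rewrite setTI; exact: (measurable_discrete (f @^-1` Y)).
rewrite -[X in \int[_]_(w in X) _]F_cover ge0_integral_bigcup//; last first.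
  by rewrite F_cover.
rewrite nneseries_esumT; last by move=> n; apply: integral_ge0.
rewrite (esum_inj (e := pickle : S -> nat)).
- apply: eq_esum => s _; rewrite F_pickle.
  rewrite (eq_integral (cst (f s))).
    by rewrite integral_cst// muleC.
  by move=> w; rewrite inE /= => ->.
- exact: pcan_inj pickleK.
- by move=> n; apply: integral_ge0.
- by move=> n /F_out ->; rewrite integral_set0.
Qed.

Lemma measure_discrete (A : set S) :
  Pr (Z @^-1` A) =
  \esum_(s in [set: S]) (if s \in A then Pr (Z @^-1` [set s]) else 0).
Proof.
transitivity (\int[Pr]_w (\1_A (Z w))%:E).
  transitivity (\int[Pr]_w (\1_(Z @^-1` A) w)%:E); last first.
    by apply: eq_integral => w _; rewrite !indicE.
  by rewrite integral_indic ?setIT//; exact: measurable_discrete.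
rewrite (@integral_discrete (fun s => (\1_A s)%:E)).
  apply: eq_esum => s _; rewrite indicE.
  by case: (s \in A); rewrite ?mule1 ?mule0.
by move=> s; rewrite lee_fin.
Qed.

End DiscreteVariable.

Section MarkovLaw.
Context {R : realType} {d : measure_display} {Omega : measurableType d}.
Variable Pr : probability Omega R.
Context {T : countType}.
Variables (X : nat -> Omega -> T) (x0 : T) (p : T -> T -> R).
Hypothesis p0 : forall x y, (0 <= p x y)%R.
Hypothesis chain : markov_chain Pr X x0 p.
Local Open Scope ereal_scope.

(** The Markov property is stated for cylinders only, so laws are obtained by summing over whole
    trajectories. *)
Let traj n w : seq T := mkseq (X ^~ w) n.+1.

Let mX n A : measurable (X n @^-1` A). Proof. by case: chain => + _ _; apply. Qed.

Let traj_cylinder n (t : seq T) : size t = n.+1 -> traj n @^-1` [set t] =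
  [set w | forall k, (k <= n)%N -> X k w = nth x0 t k].
Proof.
move=> tn; apply/seteqP; split=> w /=.
  by move=> <- k kn; rewrite nth_mkseq.
move=> h; apply: (@eq_from_nth _ x0); first by rewrite size_mkseq.
by move=> k; rewrite size_mkseq => kn; rewrite nth_mkseq// h.
Qed.

Let traj_size n (t : seq T) : size t != n.+1 -> traj n @^-1` [set t] = set0.
Proof.
move=> tn; apply/seteqP; split=> w //= wt.
by move: tn; rewrite -wt size_mkseq eqxx.
Qed.

Let mtraj n t : measurable (traj n @^-1` [set t]).
Proof.
have [tn|/traj_size ->] := eqVneq (size t) n.+1; last exact: measurable0.
rewrite traj_cylinder// (_ : [set w | _] =
  \bigcap_(k in [set k | (k <= n)%N]) X k @^-1` [set nth x0 t k]).
  by apply: bigcap_measurable => [|k _]; [exists 0%N|exact: mX].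
by apply/seteqP; split=> w /= h k; apply: h.
Qed.

Let traj_last n w : last x0 (traj n w) = X n w.
Proof. by rewrite (last_nth x0) size_mkseq /= nth_mkseq. Qed.

Let law_traj n x : Pr (X n @^-1` [set x]) =
  \esum_(t in [set: seq T]) (if last x0 t == x
     then Pr (traj n @^-1` [set t]) else 0).
Proof.
rewrite (_ : X n @^-1` _ = traj n @^-1` [set t | last x0 t = x]).
  rewrite measure_discrete//; apply: eq_esum => t _.
  by rewrite (_ : (t \in _) = (last x0 t == x))//; apply/idP/eqP; rewrite inE.
by apply/seteqP; split=> w; rewrite /preimage /mkset traj_last.
Qed.

Let traj_step n t x : Pr (traj n.+1 @^-1` [set rcons t x]) =
  Pr (traj n @^-1` [set t]) * (p (last x0 t) x)%:E.
Proof.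
have [tn|tn] := eqVneq (size t) n.+1; last first.
  by rewrite !traj_size ?measure0 ?mul0e// size_rcons eqSS.
rewrite !traj_cylinder ?size_rcons ?tn//.
have [_ _ ->] := chain; congr (Pr _ * (p _ _)%:E).
- by apply/seteqP; split=> w /= h k kn; rewrite h// nth_rcons tn ltnS kn.
- by rewrite nth_rcons tn ltnSn (last_nth x0) tn.
- by rewrite nth_rcons tn ltnn eqxx.
Qed.

Lemma law_nstep n x : Pr (X n @^-1` [set x]) = nstep p n x0 x.
Proof.
elim: n x => [|n IH] x.
  have [_ X0 _] := chain.
  have [->|xx] := eqVneq x x0; first by rewrite X0 /= eqxx.
  rewrite /= eq_sym (negPf xx).
  apply/eqP; rewrite eq_le measure_ge0 andbT.
  apply: (@le_trans _ _ (Pr (~` (X 0%N @^-1` [set x0])))).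
    by apply: le_measure; rewrite ?inE; [exact: mX|exact/measurableC/mX|move=> w /= ->; exact/eqP].
  by rewrite probability_setC ?X0 ?subee//; exact: mX.
rewrite nstepSr// law_traj.
rewrite (esum_inj (e := fun t => rcons t x)).
- transitivity (\esum_(t in [set: seq T]) \esum_(u in [set: T])
    (if last x0 t == u then Pr (traj n @^-1` [set t]) * (p u x)%:E else 0)).
    apply: eq_esum => t _; rewrite last_rcons eqxx traj_step.
    rewrite (esum_delta (x := last x0 t)) ?eqxx//.
      by move=> u; case: ifP => // _; rewrite mule_ge0// lee_fin.
    by move=> u; rewrite eq_sym => /negPf ->.
  rewrite esum_swap; last by move=> t u; case: ifP => // _; rewrite mule_ge0// lee_fin.
  apply: eq_esum => u _; rewrite -IH law_traj -esumZr ?lee_fin//.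
    by apply: eq_esum => t _; case: ifP; rewrite ?mul0e.
  by move=> t; case: ifP.
- by move=> t s /rcons_inj[].
- by move=> t; case: ifP.
- case/lastP => [|t y] ny.
    by rewrite traj_size//; case: ifP; rewrite ?measure0.
  rewrite last_rcons; case: eqP => // yx; case: ny; exists t.
  by rewrite yx.
Qed.

End MarkovLaw.

(** * Entropy *)

Section EntropyOfGreen.
Context {R : realType} {d : measure_display} {Omega : measurableType d}.
Variable Pr : probability Omega R.
Context {T : countType}.
Variables (X : nat -> Omega -> T) (G : T -> R) (len : T -> nat) (l : R).
Hypothesis mX : forall n A, measurable (X n @^-1` A).
Local Notation pi := (law Pr X).
Hypothesis pi_le_G : forall n x, pi n x <= G x.
Hypothesis pi_len : forall n x, pi n x != 0 -> (len x <= n)%N.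
Hypothesis damped : forall kappa, 0 < kappa ->
  (\esum_(x in [set: T]) (G x * expR (- kappa * (len x)%:R))%:E < +oo)%E.
Hypothesis below : forall eta, 0 <= eta -> eta < l -> exists2 t, 0 < t &
  (\esum_(n in [set: nat]) \esum_(x in [set: T])
    ((pi n x)%:E * (expR (t * (eta * n%:R + ln (G x))))%:E) < +oo)%E.
Hypothesis above : forall eta, 0 <= eta -> l < eta -> exists2 t, 0 < t &
  (\esum_(n in [set: nat]) \esum_(x in [set: T])
    ((pi n x)%:E * (expR (- t * (eta * n%:R + ln (G x))))%:E) < +oo)%E.

Lemma lawE n x : Pr (X n @^-1` [set x]) = (pi n x)%:E.
Proof.
rewrite /law fineK// ge0_fin_numE//.
by rewrite (le_lt_trans (probability_le1 _ _)) ?ltry.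
Qed.

Lemma law_ge0 n x : 0 <= pi n x. Proof. exact: fine_ge0. Qed.

Lemma law_le1 n x : pi n x <= 1.
Proof. by rewrite -lee_fin -lawE; exact: probability_le1. Qed.

Lemma integral_law n (f : T -> \bar R) : (forall x, 0 <= f x)%E ->
  (\int[Pr]_w f (X n w) = \esum_(x in [set: T]) ((pi n x)%:E * f x))%E.
Proof.
move=> f0; rewrite (integral_discrete _ _ f0); last by move=> s; exact: mX.
by apply: eq_esum => x _; rewrite lawE.
Qed.

Lemma law_mass n : (\esum_(x in [set: T]) (pi n x)%:E = 1)%E.
Proof.
transitivity (\int[Pr]_w (cst 1%E (X n w)))%E.
  by rewrite (@integral_law n (cst 1%E))//; apply: eq_esum => x _; rewrite mule1.
rewrite (integral_cst Pr measurableT 1%E) mul1e; exact: probability_setT.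
Qed.

Lemma measurable_law_fun d' (U : measurableType d') n (f : T -> U) :
  measurable_fun [set: Omega] (fun w => f (X n w)).
Proof. by move=> _ Y mY; rewrite setTI; exact: (mX n (f @^-1` Y)). Qed.

(** The threshold may be negative a priori, whereas -log pi_n is not. For [l <= 0] the lower bound
    is trivial and [above] still gives the upper one. *)
Let L := Num.max l 0.

Lemma neg_ln_law_ge0 n x : 0 <= - ln (pi n x).
Proof. by rewrite oppr_ge0 ln_le0// law_le1. Qed.

(* E[sum_n exp(t (eta n + ln G(X_n)))] is finite, so its terms tend to zero
   almost surely; the value +oo at states of probability zero discards them. *)
Lemma entropy_lower eta : 0 <= eta -> eta < l ->
  {ae Pr, forall w, exists N, forall n, (N <= n)%N ->
    eta <= - ln (pi n (X n w)) / n%:R}.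
Proof.
move=> eta0 etal; have [t t0 fin] := below eta0 etal.
pose f n x : \bar R := if pi n x == 0 then +oo%E
  else (expR (t * (eta * n%:R + ln (G x))))%:E.
have f0 n x : (0 <= f n x)%E.
  by rewrite /f; case: ifP => // _; rewrite lee_fin expR_ge0.
pose S w := (\sum_(n <oo) f n (X n w))%E.
have mf n : measurable_fun [set: Omega] (fun w => f n (X n w)).
  exact: measurable_law_fun.
have S0 w : (0 <= S w)%E by apply: nneseries_ge0.
have mS : measurable_fun [set: Omega] S.
  apply: (@ge0_emeasurable_sum _ _ _ _ (fun n w => f n (X n w)) xpredT) => //.
have intS : (\int[Pr]_w S w < +oo)%E.
  rewrite integral_nneseries//.
  rewrite nneseries_esumT; last by move=> n; apply: integral_ge0.
  apply: le_lt_trans fin; apply: le_esum => n _; rewrite integral_law//.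
  apply: le_esum => x _; rewrite /f; case: eqP => [->|//].
  by rewrite !mul0e.
have iS : Pr.-integrable [set: Omega] S.
  apply/integrableP; split=> //.
  by under eq_integral do rewrite gee0_abs//.
apply: filterS (integrable_ae measurableT iS) => w /(_ Logic.I) Sw.
have Sfin : (S w < +oo)%E by rewrite -ge0_fin_numE.
have := nneseries_tail_cvg Sfin (fun n _ => f0 n (X n w)).
move=> /fine_cvgP[[N1 _ tfin] /cvgr_lt/(_ 1 ltr01)[N2 _ tlt]].
exists (maxn 1 (maxn N1 N2)) => n; rewrite !geq_max => /and3P[n1 nN1 nN2].
have fn1 : (f n (X n w) < 1)%E.
  apply: (@le_lt_trans _ _ (\sum_(n <= k <oo) f k (X k w))%E).
    by rewrite (nneseries_split n 1)// addn1 big_nat1 leeDl// nneseries_ge0.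
  by rewrite -(fineK (tfin n nN1)) lte_fin; exact: tlt n nN2.
have n0 : 0 < n%:R :> R by rewrite ltr0n.
rewrite ler_pdivlMr// lerNr.
move: fn1; rewrite /f; case: eqVneq => [//|pn0].
(* A term below 1 has a negative exponent: eta n < - log G(X_n) <= - log pi_n(X_n). *)
rewrite lte_fin -expR0 ltr_expR pmulr_rlt0// => h.
have pi0 : 0 < pi n (X n w) by rewrite lt_def pn0 law_ge0.
have G0 : 0 < G (X n w) by exact: lt_le_trans pi0 (pi_le_G _ _).
have : ln (pi n (X n w)) <= ln (G (X n w)) by rewrite ler_ln ?posrE.
lra.
Qed.

(* Gibbs' inequality against the finite measure G(x) exp(-kappa len x), then
   v <= exp v applied to v = - t (eta n + ln G(x)). *)
Lemma neg_ln_law_le (kappa eta t : R) n x : 0 < t -> 0 < kappa ->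
  pi n x * - ln (pi n x) <= G x * expR (- kappa * (len x)%:R) +
    (kappa + eta) * n%:R * pi n x +
    t^-1 * (pi n x * expR (- t * (eta * n%:R + ln (G x)))).
Proof.
move=> t0 kappa0.
have G0 : 0 <= G x by apply: le_trans (pi_le_G n x); exact: law_ge0.
have [pi0|pin0] := eqVneq (pi n x) 0.
  by rewrite pi0 !mul0r !mulr0 !addr0 mulr_ge0// expR_ge0.
have pip : 0 < pi n x by rewrite lt_def pin0 law_ge0.
have Gp : 0 < G x by exact: lt_le_trans pip (pi_le_G n x).
set mu := G x * expR _; set v := - t * (eta * n%:R + ln (G x)).
have mup : 0 < mu by rewrite mulr_gt0// expR_gt0.
have h1 : ln (mu / pi n x) <= mu / pi n x by rewrite ltW// ln_sublinear// divr_gt0.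
have h2 : v <= expR v by apply: le_trans (expR_ge1Dx v); rewrite lerDr.
have h3 : (len x)%:R <= n%:R :> R by rewrite ler_nat pi_len.
have h4 : ln mu = ln (G x) - kappa * (len x)%:R.
  by rewrite lnM ?posrE ?expR_gt0// expRK mulNr.
rewrite ln_div ?posrE// in h1.
have h5 : - ln (G x) <= t^-1 * expR v + eta * n%:R.
  have : t^-1 * v <= t^-1 * expR v by rewrite ler_pM2l// invr_gt0.
  rewrite {1}/v mulrA mulrN mulVf ?gt_eqF// mulN1r; lra.
have h6 : kappa * (len x)%:R <= kappa * n%:R by rewrite ler_pM2l.
have : - ln (pi n x) <= mu / pi n x + (kappa + eta) * n%:R + t^-1 * expR v by lra.
rewrite -(ler_pM2l pip) => /le_trans; apply.
rewrite le_eqVlt; apply/orP; left; apply/eqP.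
by rewrite !mulrDr; congr (_ + _ + _); [rewrite mulrCA divff// mulr1|ring|ring].
Qed.

Lemma integral_entropy_rate n :
  (\int[Pr]_w (- ln (pi n (X n w)) / n%:R)%:E =
   n%:R^-1%:E * \int[Pr]_w (- ln (pi n (X n w)))%:E)%E.
Proof.
rewrite -ge0_integralZl_EFin//.
- by apply: eq_integral => w _; rewrite mulrC EFinM.
- by move=> w _; rewrite lee_fin neg_ln_law_ge0.
- exact: (@measurable_law_fun _ _ n (fun x => (- ln (pi n x))%:E)).
Qed.

Lemma entropy_upper (e : R) : 0 < e -> exists N, forall n, (N <= n)%N ->
  (\int[Pr]_w (- ln (pi n (X n w)) / n%:R)%:E <= (L + e)%:E)%E.
Proof.
move=> e0; pose kappa := e / 3; have kappa0 : 0 < kappa by rewrite divr_gt0.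
(* One third of [e] each for [kappa], for the excess of [eta] over [L], and for the constant [C]
   after division by n. *)
pose eta := L + e / 3.
have eta0 : 0 <= eta by rewrite addr_ge0 ?divr_ge0 ?(ltW e0)// le_max lexx orbT.
have leta : l < eta.
  by apply: (@le_lt_trans _ _ L); [rewrite le_max lexx|rewrite ltrDl divr_gt0].
have [t t0 fin] := above eta0 leta; have finZ := damped kappa0.
set Z := (X in (X < +oo)%E) in finZ; set S := (X in (X < +oo)%E) in fin.
have G0 x : 0 <= G x by apply: le_trans (pi_le_G 0 x); exact: law_ge0.
have Z0 : (0 <= Z)%E.
  by apply: esum_ge0 => x _; rewrite lee_fin mulr_ge0// expR_ge0.
have pie0 n x (v : R) : (0 <= (pi n x)%:E * (expR v)%:E)%E.
  by rewrite mule_ge0// lee_fin ?law_ge0// expR_ge0.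
have S0 : (0 <= S)%E by apply: esum_ge0 => n _; apply: esum_ge0.
have Zf : Z \is a fin_num by rewrite ge0_fin_numE.
have Sf : S \is a fin_num by rewrite ge0_fin_numE.
pose C := fine Z + t^-1 * fine S.
have C0 : 0 <= C.
  by rewrite addr_ge0 ?mulr_ge0 ?fine_ge0// invr_ge0 ltW.
have bound n : (\int[Pr]_w (- ln (pi n (X n w)))%:E <=
    (C + (kappa + eta) * n%:R)%:E)%E.
  rewrite (@integral_law n (fun x => (- ln (pi n x))%:E)); last first.
    by move=> x; rewrite lee_fin neg_ln_law_ge0.
  have ke0 : 0 <= (kappa + eta) * n%:R by rewrite mulr_ge0// addr_ge0// ltW.
  have ti0 : (0 <= t^-1%:E)%E by rewrite lee_fin invr_ge0 ltW.
  apply: (@le_trans _ _ (\esum_(x in [set: T])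
    ((G x * expR (- kappa * (len x)%:R))%:E +
     ((kappa + eta) * n%:R)%:E * (pi n x)%:E +
     t^-1%:E * ((pi n x)%:E * (expR (- t * (eta * n%:R + ln (G x))))%:E)))%E).
    apply: le_esum => x _; rewrite -!EFinM -!EFinD lee_fin.
    exact: neg_ln_law_le.
  rewrite esumD; last 2 first.
  - move=> x _; apply: adde_ge0; first by rewrite lee_fin mulr_ge0// expR_ge0.
    by rewrite mule_ge0 ?lee_fin ?law_ge0.
  - by move=> x _; rewrite mule_ge0.
  rewrite esumD; last 2 first.
  - by move=> x _; rewrite lee_fin mulr_ge0// expR_ge0.
  - by move=> x _; rewrite mule_ge0 ?lee_fin ?law_ge0.
  rewrite esumZl ?lee_fin//; last by move=> x; rewrite lee_fin law_ge0.
  rewrite law_mass mule1 esumZl// -/Z.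
  have -> : ((C + (kappa + eta) * n%:R)%:E =
      Z + ((kappa + eta) * n%:R)%:E + t^-1%:E * S)%E.
    by rewrite /C !EFinD EFinM !fineK// addeAC.
  apply: leeD2l; apply: lee_wpmul2l => //.
  apply: (@esum_term_le R nat (fun n => \esum_(x in [set: T])
    ((pi n x)%:E * (expR (- t * (eta * n%:R + ln (G x))))%:E))%E n).
  by move=> m; apply: esum_ge0.
exists (Num.truncn (3 * C / e)).+1 => n Nn.
have n0 : 0 < n%:R :> R by rewrite ltr0n (leq_trans _ Nn).
have nC : 3 * C / e <= n%:R.
  by apply: ltW; apply: lt_le_trans (truncnS_gt _) _; rewrite ler_nat.
rewrite integral_entropy_rate.
apply: le_trans (lee_wpmul2l _ (bound n)) _; first by rewrite lee_fin invr_ge0 ltW.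
rewrite -EFinM lee_fin ler_pdivrMl// /eta /kappa.
move: nC; rewrite ler_pdivrMr//; lra.
Qed.

Lemma entropy_of_green :
  {ae Pr, forall w : Omega, asymptotic_entropy Pr X =
     limn_einf (fun n : nat => (- ln (pi n (X n w)) / n%:R)%:E)}.
Proof.
have L0 : 0 <= L by rewrite le_max lexx orbT.
have Y0 n w : 0 <= - ln (pi n (X n w)) / n%:R.
  by rewrite divr_ge0// neg_ln_law_ge0.
have lower : {ae Pr, forall w, forall m : nat, exists N, forall n, (N <= n)%N ->
    L - m.+1%:R^-1 <= - ln (pi n (X n w)) / n%:R}.
  (* In the second case [L > 0], so that [L = l] and [entropy_lower] applies with an admissible
     [eta]. *)
  apply: ae_foralln => m; have [neg|pos] := ltP (L - m.+1%:R^-1) 0.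
    apply: filterE => w; exists 0%N => n _.
    by apply: le_trans (ltW neg) _; exact: Y0.
  apply: entropy_lower => //.
  have m0 : 0 < m.+1%:R^-1 :> R by rewrite invr_gt0.
  have : 0 < L by rewrite subr_ge0 in pos; exact: lt_le_trans m0 pos.
  rewrite /L lt_max ltxx orbF => l0; rewrite max_l ?(ltW l0)//.
  by rewrite ltrBlDr ltrDl.
have [cv ae] := liminf_of_expectation
  (fun n => @measurable_law_fun _ R n (fun x => - ln (pi n x) / n%:R))
  Y0 L0 lower entropy_upper.
apply: filterS ae => w ->; rewrite /asymptotic_entropy.
apply/cvg_lim => //; apply: cvg_trans cv; apply: near_eq_cvg.
by apply: nearW => n; rewrite unlock integral_entropy_rate.
Qed.

End EntropyOfGreen.

(** * Word length along the walk, and the theorem *)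

Section WordLength.
Context {R : realType} {r : nat} {V : 'I_r -> countType}.
Variables (o : forall i, V i) (p : forall i, V i -> V i -> R).
Variable alpha : 'I_r -> R.

(** A step changes only the [V i]-coordinate, hence lengthens the word by at most one; this gives
    |X_n| <= n in the entropy bound. *)
Lemma size_append_prefix_part (x : seq (letter V)) i (c : V i) :
  (size x <= (size (append o (prefix_part i x) c)).+1)%N.
Proof.
have h : (size (prefix_part i x) <= size (append o (prefix_part i x) c))%N.
  by rewrite /append; case: ifP => // _; rewrite size_rcons.
apply: (@leq_trans (size (prefix_part i x)).+1); last by rewrite ltnS.
rewrite /prefix_part; case: ifP => // _; rewrite size_take.
by case: (size x) => //= n; rewrite ltnSn.
Qed.

Lemma visit_size n (x : seq (letter V)) :
  (n < size x)%N -> visit o p alpha n x = 0%E.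
Proof.
elim: n x => [|n IH] x xn /=; first by case: x xn.
apply: big1 => i _; rewrite esum1 ?mule0// => c _.
by rewrite IH ?mul0e// -ltnS (leq_trans xn)// size_append_prefix_part.
Qed.

End WordLength.

Theorem corollary3p9 (R : realType) (r : nat) (V : 'I_r -> countType)
    (o : forall i : 'I_r, V i) (p : forall i : 'I_r, V i -> V i -> R)
    (alpha : 'I_r -> R)
    (d : measure_display) (Omega : measurableType d)
    (Pr : probability Omega R) (X : nat -> Omega -> free_product o)
    (r_ge2 : (2 <= r)%N)
    (not_two_pairs : ~ (r = 2%N /\ forall i : 'I_r, ([set: V i] #= `I_2)%card))
    (p_stochastic : forall i : 'I_r, stochastic (p i))
    (p_reachable : forall (i : 'I_r) (x : V i),
       exists n : nat, (0 < nstep (p i) n (o i) x)%E)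
    (p_noloop : forall (i : 'I_r) (x : V i), p i x x = 0)
    (p_unif : forall i : 'I_r, uniformly_irreducible (p i))
    (alpha_gt0 : forall i : 'I_r, 0 < alpha i)
    (alpha_sum1 : \sum_(i < r) alpha i = 1)
    (X_chain : markov_chain Pr X (empty_word o)
       (free_product_matrix p alpha))
    (R_gt1 : (1 < green_radius (free_product_matrix (o := o) p alpha))%E) :
  {ae Pr, forall w : Omega,
     asymptotic_entropy Pr X =
     limn_einf (fun n : nat => (- ln (law Pr X n (X n w)) / n%:R)%:E)}.
Proof.
have p0 i (x y : V i) : 0 <= p i x y by have [] := p_stochastic i.
have p1 i (x : V i) : (\esum_(y in [set: V i]) (p i x y)%:E = 1)%E.
  by have [] := p_stochastic i.
have al0 i : 0 <= alpha i by exact: ltW.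
have [d0 [rho [M [d_gt0 d_crit rho1 gM bM]]]] :=
  renewal_data r_ge2 p0 p1 p_noloop alpha_gt0 alpha_sum1 R_gt1.
have [l lP] := green_threshold_radius r_ge2 p0 p1 p_noloop alpha_gt0 alpha_sum1
  rho1 gM bM p_reachable p_unif d_gt0 d_crit.
have mX n A : measurable (X n @^-1` A) by have [+ _ _] := X_chain; apply.
have lawP n x : (law Pr X n x)%:E = visit o p alpha n (val x).
  rewrite -nstep_visit// -(lawE Pr mX).
  by apply: (law_nstep _ X_chain); exact: free_product_matrix_ge0.
apply: (@entropy_of_green _ _ _ _ _ X (fun x => green o p alpha 1 (val x))
  (fun x => size (val x)) l) => //.
- move=> n x; rewrite -lee_fin lawP.
  by apply: (visit_le_green p0 p1 alpha_gt0 alpha_sum1 rho1 gM bM); exact: valP.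
- move=> n x; apply: contraNT; rewrite -ltnNge => nx.
  by rewrite -eqe lawP visit_size.
- exact: (damped_words_finite r_ge2 p0 p1 p_noloop alpha_gt0 alpha_sum1
    rho1 gM bM d_gt0 d_crit).
- move=> eta eta0 etal; have [/(_ etal)[t t0 fin] _] := lP eta eta0.
  exists t => //; apply: le_lt_trans fin; apply: le_esum => n _.
  by apply: le_esum => x _; rewrite lawP.
- move=> eta eta0 etal; have [_ /(_ etal)[t t0 fin]] := lP eta eta0.
  exists t => //; apply: le_lt_trans fin; apply: le_esum => n _.
  by apply: le_esum => x _; rewrite lawP.
Qed.
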